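(* The induced relations for the singular point $(0,0)$ of the curve $S$ given by $y(y^2+x)(y^2-x)=0$ are: $$\text{(1) } x_4x_3x_2=x_2x_4x_3,\qquad \text{(2) } x_3x_2x_4x_3x_4=x_4x_3x_2x_4x_3,\qquad \text{(3) } x_1=x_4x_3x_4^{-1},\qquad \text{(4) } x_4=x_5,$$ where $\{x_1,x_2,x_3,x_4,x_5\}$ are the generators of the standard g-base.
   Context: Let $E=\{x\in\mathbb{C}:|x|\le 1\}$, $D=\{y\in\mathbb{C}:|y|\le 4\}$, regard $S$ as a curve in $E\times D$; its fibers over $E$ have $5$ points except over $x=0$. The fiber over $x=1$ is $K=\{0,1,-1,i,-i\}\subset D$. Let $u_0=-4i$. A motion of a finite set in $D$ consists of continuous functions $m_i:[0,1]\to D$ with pairwise distinct values at each time, starting at the points of the set. It is realized by a continuous family of diffeomorphisms $D_t$ of $D$, $D_0=\mathrm{Id}$, equal to the identity on $\partial D$, with $D_t(m_i(0))=m_i(t)$; we say it induces $D_1$. The local braid monodromy $\beta$ of $S$ at $(0,0)$ is the braid (class of a diffeomorphism of $D$ preserving $K$, identity on $\partial D$, up to having the same action on $\pi_1(D-K,u_0)$) induced by the motion formed by the points of $S$ over $x=e^{2\pi i t}$, $0\le t\le 1$. Standard g-base for this fiber, which has two non-real points: in the model set of real points $p_1=-1,\ p_2=0,\ p_3=1,\ p_4=2,\ p_5=3$, let the $i$-th loop go from $u_0$ along the straight segment to near $p_i$, once counterclockwise around $p_i$ on a small circle, and back. Move the model set to $K$ as follows, keeping $p_1,p_2,p_3$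 fixed: rotate $p_4,p_5$ by $90^\circ$ counterclockwise about their midpoint $5/2$ (so $p_4$ becomes the lower point $\frac52-\frac i2$ and $p_5$ the upper point $\frac52+\frac i2$), move them vertically to $\frac52-i$ and $\frac52+i$, and then horizontally to the left to $-i$ and $i$ respectively. The loops $x_1,\dots,x_5$ are the images of the five loops under the diffeomorphism induced by this motion. In a product of loops the left factor is traversed first. The group $\pi_1(D-K,u_0)$ is free on $x_1,\dots,x_5$. The relations induced by $\beta$ are $\beta(x_j)=x_j$, $j=1,\dots,5$. Saying that ''the induced relations are $R$'' means that $R$ and $\{\beta(x_j)=x_j\}_j$ have the same normal closure in the free group on $x_1,\dots,x_5$. *)

(* Defs.v *)
(** Stdlib reals with Coquelicot: [C] is [R * R] with the product topology. *)
From Stdlib Require Import Reals List.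
From Coquelicot Require Import Coquelicot.
Import ListNotations.
Open Scope R_scope.

Definition I01 (t : R) : Prop := 0 <= t <= 1.

Definition cis (a : R) : C := (cos a, sin a).

Definition E (x : C) : Prop := Cmod x <= 1.
Definition D (y : C) : Prop := Cmod y <= 4.
Definition bdD (y : C) : Prop := Cmod y = 4.

Definition curve_S (x y : C) : Prop :=
  E x /\ D y /\ (y * (y * y + x) * (y * y - x))%C = 0%C.

Definition K (y : C) : Prop := In y [RtoC 0; RtoC 1; RtoC (-1); Ci; (- Ci)%C].

Definition u0 : C := (0, -4).

Definition DK (y : C) : Prop := D y /\ ~ K y.

(** * Diffeomorphisms of the closed disk *)

(** [F] is of class C^n on the plane: all iterated partial derivatives up to
    order [n] exist and are continuous. *)
Fixpoint class_C (n : nat) (F : C -> C) : Prop :=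
  (forall z, continuous F z) /\
  match n with
  | O => True
  | S k => exists Fx Fy : C -> C,
      (forall x y : R, is_derive (fun s : R => F (s, y)) x (Fx (x, y))) /\
      (forall x y : R, is_derive (fun s : R => F (x, s)) y (Fy (x, y))) /\
      class_C k Fx /\ class_C k Fy
  end.

(** Smoothness up to the boundary: [f] extends from [D] to a smooth map of the
    plane.  Values of [f] outside [D] are irrelevant, here and below. *)
Definition smooth_on_D (f : C -> C) : Prop :=
  exists F : C -> C, (forall n, class_C n F) /\ (forall y, D y -> F y = f y).

Definition diffeo_D (f : C -> C) : Prop :=
  smooth_on_D f /\ (forall y, D y -> D (f y)) /\
  exists g : C -> C,
    smooth_on_D g /\ (forall y, D y -> D (g y)) /\
    (forall y, D y -> g (f y) = y) /\ (forall y, D y -> f (g y) = y).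

Definition fixes_bdD (f : C -> C) : Prop := forall y, bdD y -> f y = y.

(** * Motions of five-point sets, the points being numbered 1, ..., 5 *)

Definition idx (i : nat) : Prop := (1 <= i <= 5)%nat.

Definition is_motion (P : C -> Prop) (m : nat -> R -> C) : Prop :=
  (forall i, idx i -> continuous_on I01 (m i)) /\
  (forall i t, idx i -> I01 t -> D (m i t)) /\
  (forall i j t, idx i -> idx j -> I01 t -> m i t = m j t -> i = j) /\
  (forall y, P y <-> exists i, idx i /\ m i 0 = y).

Definition realizes (m : nat -> R -> C) (h : R -> C -> C) : Prop :=
  continuous_on (fun p : R * C => I01 (fst p) /\ D (snd p))
                (fun p : R * C => h (fst p) (snd p)) /\
  (forall t, I01 t -> diffeo_D (h t) /\ fixes_bdD (h t)) /\
  (forall y, D y -> h 0 y = y) /\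
  (forall i t, idx i -> I01 t -> h t (m i 0) = m i t).

Definition induces (m : nat -> R -> C) (f : C -> C) : Prop :=
  exists h, realizes m h /\ forall y, D y -> f y = h 1 y.

(** * The fundamental group of [D - K] at [u0]

    Its elements are represented by loops, parametrized by [0, 1]; equality in
    the group is [homotopic]. *)

Definition is_loop (a : R -> C) : Prop :=
  continuous_on I01 a /\ (forall t, I01 t -> DK (a t)) /\ a 0 = u0 /\ a 1 = u0.

Definition homotopic (a b : R -> C) : Prop :=
  exists H : R * R -> C,
    continuous_on (fun p : R * R => I01 (fst p) /\ I01 (snd p)) H /\
    (forall s t, I01 s -> I01 t -> DK (H (s, t))) /\
    (forall t, I01 t -> H (0, t) = a t /\ H (1, t) = b t) /\
    (forall s, I01 s -> H (s, 0) = u0 /\ H (s, 1) = u0).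

Definition lone : R -> C := fun _ => u0.

(** The left factor is traversed first. *)
Definition lmul (a b : R -> C) : R -> C :=
  fun t => if Rle_dec t (1 / 2) then a (2 * t) else b (2 * t - 1).

Definition linv (a : R -> C) : R -> C := fun t => a (1 - t).

Declare Scope loop_scope.
Delimit Scope loop_scope with L.
Infix "*" := lmul : loop_scope.
Notation "a ^-1" := (linv a) (at level 3, left associativity, format "a ^-1")
  : loop_scope.

(** A relation [l = r] is a pair [(l, r)].  The loops [a] with
    [normal_closure rels a] are those whose class lies in the smallest normal
    subgroup of the fundamental group containing all the [l * r^-1]. *)
Inductive normal_closure (rels : list ((R -> C) * (R -> C))) : (R -> C) -> Prop :=
| nc_rel l r : In (l, r) rels -> normal_closure rels (l * r^-1)%L
| nc_one : normal_closure rels lone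
| nc_mul a b : normal_closure rels a -> normal_closure rels b ->
    normal_closure rels (a * b)%L
| nc_inv a : normal_closure rels a -> normal_closure rels (a^-1)%L
| nc_conj g a : is_loop g -> normal_closure rels a ->
    normal_closure rels (g * a * g^-1)%L
| nc_homotopic a b : homotopic a b -> normal_closure rels a ->
    normal_closure rels b.

Definition same_normal_closure (rels rels' : list ((R -> C) * (R -> C))) : Prop :=
  forall a, normal_closure rels a <-> normal_closure rels' a.

(** * The local braid monodromy of the curve at the origin *)

Definition fiber_motion (m : nat -> R -> C) : Prop :=
  is_motion K m /\
  forall t, I01 t ->
    forall y, curve_S (cis (2 * PI * t)) y <-> exists i, idx i /\ m i t = y.

Definition braid_diffeo (f : C -> C) : Prop :=
  diffeo_D f /\ fixes_bdD f /\ (forall y, D y -> (K (f y) <-> K y)).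

Definition same_action (f g : C -> C) : Prop :=
  forall a, is_loop a -> homotopic (fun t => f (a t)) (fun t => g (a t)).

(** [beta] is a diffeomorphism representing the local braid monodromy. *)
Definition local_braid_monodromy (beta : C -> C) : Prop :=
  braid_diffeo beta /\
  exists m f, fiber_motion m /\ induces m f /\ same_action beta f.

(** * The standard g-base *)

Definition model_pt (i : nat) : C := RtoC (INR i - 2).

(** The moving points 4 and 5 are [model_center t - model_arm t] and
    [model_center t + model_arm t]; each of the three moves takes a third of
    the time. *)
Definition model_center (t : R) : C :=
  if Rle_dec t (2 / 3) then RtoC (5 / 2) else RtoC (5 / 2 * (3 - 3 * t)).

Definition model_arm (t : R) : C :=
  if Rle_dec t (1 / 3) then (RtoC (1 / 2) * cis (PI / 2 * (3 * t)))%C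
  else if Rle_dec t (2 / 3) then (0, 1 / 2 + 1 / 2 * (3 * t - 1))
  else (0, 1).

Definition model_motion (i : nat) (t : R) : C :=
  match i with
  | 4%nat => (model_center t - model_arm t)%C
  | 5%nat => (model_center t + model_arm t)%C
  | _ => model_pt i
  end.

Definition model_dir (i : nat) : C :=
  ((u0 - model_pt i) / RtoC (Cmod (u0 - model_pt i)))%C.

(** Straight towards [model_pt i] up to distance [eps], once counterclockwise
    around the circle of radius [eps], and back. *)
Definition model_loop (eps : R) (i : nat) (t : R) : C :=
  let q := (model_pt i + RtoC eps * model_dir i)%C in
  if Rle_dec t (1 / 3) then (u0 + RtoC (3 * t) * (q - u0))%C
  else if Rle_dec t (2 / 3) then
    (model_pt i + RtoC eps * model_dir i * cis (2 * PI * (3 * t - 1)))%C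
  else (u0 + RtoC (3 - 3 * t) * (q - u0))%C.

(** [eps < 1/2] makes the disks of radius [eps] around the model points disjoint. *)
Definition standard_gbase (x : nat -> R -> C) : Prop :=
  exists (eps : R) (g : C -> C),
    0 < eps < 1 / 2 /\ induces model_motion g /\
    forall i t, idx i -> I01 t -> x i t = g (model_loop eps i t).

Definition monodromy_relations (beta : C -> C) (x : nat -> R -> C) :
    list ((R -> C) * (R -> C)) :=
  map (fun j => ((fun t => beta (x j t)), x j)) [1; 2; 3; 4; 5]%nat.

(* Main.v *)
(** If a diffeotopy [h] realizes a motion and the loops [G s] avoid the moving
    points at time [s], then [h 1] sends [G 0] to the class of [G 1], a homotopy
    being [h 1 o (h s)^-1 o G s].  Hence the class of the image of a loop does not
    depend on the realization, and each [x i] is the class of a fixed polygon that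
    avoids the paths of all the points of the model motion.  The points of [S] over
    the unit circle make a half turn about 0, so [beta] acts as a half turn of an
    inner disk.  Homotopies between polygons are found by cutting off
    triangles without punctures; they give, with [T = x5 x4 x3 x2 x1],
      [beta x1 = x4 x3 x4^-1],  [beta x2 = (x4 x3) x2 (x4 x3)^-1],
      [beta x3 = (x5^-1 T) x1 (x5^-1 T)^-1],  [beta x4 = x5],  [beta x5 = T x4 T^-1].
    The first, second and fourth relations are (3), (1) and (4).  Modulo (3) and (4),
    [T = x4 Y x4^-1] with [Y = x4 x3 x2 x4 x3], and the fifth says that [Y] commutes
    with [x4], which is (2); the third follows, as [Y] commutes with [x4 x3] by (1). *)
Require Import Defs.
From Stdlib Require Import Reals List ZArith Lra Lia Psatz ClassicalEpsilon.
From Coquelicot Require Import Coquelicot.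
Import ListNotations.
(* Again, since Coquelicot shadows [D]. *)
Import Defs.

(** * Continuity *)

(** The difficulty is that every homotopy in [DK] has to be exhibited. Each one is traced back to a
    Boolean test on polygons with integer vertices: a vertex may be deleted when every obstacle is
    strictly separated by a line from the triangle that the vertex spans with its neighbours, and
    both the triangle and the separating direction are found by evaluation. Curved pieces, namely
    the small circles and the stem twisted by the half turn, are first replaced by inscribed
    polygons; at the scale 20, circles of radius [Cmod (u0 - model_pt i) / 20] have integer quarter
    points. A rotation of the whole disk would move [u0], so it is damped to the identity between
    the radii 7/2 and 4; only the stems of the loops, which cross this ring at the bottom, are bent.
    The equations for the images are stated without inverses, so that each side is a concatenation
    of known polygons. What remains concerns words: membership of a relator in a normal closure is
    certified by an explicit product of conjugates, verified by free reduction. *)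

Lemma continuous_Rplus {T : UniformSpace} (f g : T -> R) p :
  continuous f p -> continuous g p -> continuous (fun x => f x + g x) p.
Proof. intros Hf Hg; exact (continuous_plus f g p Hf Hg). Qed.

Lemma continuous_Ropp {T : UniformSpace} (f : T -> R) p :
  continuous f p -> continuous (fun x => - f x) p.
Proof. intros Hf; exact (continuous_opp f p Hf). Qed.

Lemma continuous_Rminus {T : UniformSpace} (f g : T -> R) p :
  continuous f p -> continuous g p -> continuous (fun x => f x - g x) p.
Proof. intros Hf Hg; exact (continuous_minus f g p Hf Hg). Qed.

Lemma continuous_Rmult {T : UniformSpace} (f g : T -> R) p :
  continuous f p -> continuous g p -> continuous (fun x => f x * g x) p.
Proof. intros Hf Hg; exact (continuous_mult f g p Hf Hg). Qed.

Lemma continuous_Rcomp {T : UniformSpace} (f : T -> R) (g : R -> R) p :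
  continuous f p -> (forall r, continuous g r) -> continuous (fun x => g (f x)) p.
Proof. intros Hf Hg; exact (continuous_comp f g p Hf (Hg _)). Qed.

Lemma continuous_Rmax {T : UniformSpace} (f g : T -> R) p :
  continuous f p -> continuous g p -> continuous (fun x => Rmax (f x) (g x)) p.
Proof.
  intros Hf Hg.
  apply continuous_ext with (fun x => / 2 * (f x + g x + Rabs (f x - g x))).
  - intros x; unfold Rmax, Rabs.
    destruct (Rle_dec (f x) (g x)), (Rcase_abs (f x - g x)); lra.
  - apply continuous_Rmult; [apply continuous_const|].
    apply continuous_Rplus; [now apply continuous_Rplus|].
    apply (continuous_Rcomp (fun x => f x - g x) Rabs);
      [now apply continuous_Rminus | apply continuous_Rabs].
Qed.

Lemma continuous_Rmin {T : UniformSpace} (f g : T -> R) p :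
  continuous f p -> continuous g p -> continuous (fun x => Rmin (f x) (g x)) p.
Proof.
  intros Hf Hg.
  apply continuous_ext with (fun x => - Rmax (- f x) (- g x)).
  - intros x; unfold Rmax, Rmin.
    destruct (Rle_dec (f x) (g x)), (Rle_dec (- f x) (- g x)); lra.
  - apply continuous_Ropp, continuous_Rmax; now apply continuous_Ropp.
Qed.

Lemma continuous_pair {T U V : UniformSpace} (f : T -> U) (g : T -> V) p :
  continuous f p -> continuous g p ->
  continuous (U := prod_UniformSpace U V) (fun x => (f x, g x)) p.
Proof.
  intros Hf Hg; apply (continuous_comp_2 f g (fun a b => (a, b))); trivial.
  apply continuous_ext with (fun q : U * V => q); [now intros [] | apply continuous_id].
Qed.

Lemma continuous_toC {T : UniformSpace} (f g : T -> R) p :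
  continuous f p -> continuous g p ->
  continuous (U := C_UniformSpace) (fun x => (f x, g x)) p.
Proof. exact (continuous_pair f g p). Qed.

Lemma continuous_pfst {T U V : UniformSpace} (f : T -> U * V) p :
  continuous (U := prod_UniformSpace U V) f p -> continuous (fun x => fst (f x)) p.
Proof.
  intros Hf; apply (continuous_comp (V := prod_UniformSpace U V) f fst); trivial.
  destruct (f p); apply continuous_fst.
Qed.

Lemma continuous_psnd {T U V : UniformSpace} (f : T -> U * V) p :
  continuous (U := prod_UniformSpace U V) f p -> continuous (fun x => snd (f x)) p.
Proof.
  intros Hf; apply (continuous_comp (V := prod_UniformSpace U V) f snd); trivial.
  destruct (f p); apply continuous_snd.
Qed.

Lemma continuous_Re {T : UniformSpace} (f : T -> C) p :
  continuous f p -> continuous (fun x => fst (f x)) p.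
Proof. exact (continuous_pfst f p). Qed.

Lemma continuous_Im {T : UniformSpace} (f : T -> C) p :
  continuous f p -> continuous (fun x => snd (f x)) p.
Proof. exact (continuous_psnd f p). Qed.

Lemma continuous_Cplus {T : UniformSpace} (f g : T -> C) p :
  continuous f p -> continuous g p -> continuous (fun x => f x + g x)%C p.
Proof.
  intros Hf Hg.
  pose proof (continuous_Re f p Hf); pose proof (continuous_Re g p Hg);
    pose proof (continuous_Im f p Hf); pose proof (continuous_Im g p Hg).
  apply continuous_toC; apply continuous_Rplus; assumption.
Qed.

Lemma continuous_Cminus {T : UniformSpace} (f g : T -> C) p :
  continuous f p -> continuous g p -> continuous (fun x => f x - g x)%C p.
Proof.
  intros Hf Hg.
  pose proof (continuous_Re f p Hf); pose proof (continuous_Re g p Hg);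
    pose proof (continuous_Im f p Hf); pose proof (continuous_Im g p Hg).
  apply continuous_toC; apply continuous_Rminus; assumption.
Qed.

Lemma continuous_Cmult {T : UniformSpace} (f g : T -> C) p :
  continuous f p -> continuous g p -> continuous (fun x => f x * g x)%C p.
Proof.
  intros Hf Hg.
  pose proof (continuous_Re f p Hf); pose proof (continuous_Re g p Hg);
    pose proof (continuous_Im f p Hf); pose proof (continuous_Im g p Hg).
  apply continuous_toC; [apply continuous_Rminus | apply continuous_Rplus];
    apply continuous_Rmult; assumption.
Qed.

Lemma continuous_RtoC {T : UniformSpace} (f : T -> R) p :
  continuous f p -> continuous (fun x => RtoC (f x)) p.
Proof. intros Hf; apply continuous_toC; [exact Hf | apply continuous_const]. Qed.

Lemma continuous_cis {T : UniformSpace} (f : T -> R) p :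
  continuous f p -> continuous (fun x => cis (f x)) p.
Proof.
  intros Hf; apply continuous_toC; apply continuous_Rcomp; trivial;
    [apply continuous_cos | apply continuous_sin].
Qed.

Lemma continuous_Cmod {T : UniformSpace} (f : T -> C) p :
  continuous f p -> continuous (fun x => Cmod (f x)) p.
Proof.
  intros Hf; pose proof (continuous_Re f p Hf); pose proof (continuous_Im f p Hf).
  unfold Cmod; simpl.
  apply (continuous_Rcomp (fun x => fst (f x) * (fst (f x) * 1) + snd (f x) * (snd (f x) * 1)) sqrt);
    [|apply continuous_sqrt].
  apply continuous_Rplus; (apply continuous_Rmult; [assumption|]);
    (apply continuous_Rmult; [assumption | apply continuous_const]).
Qed.

(* The goal is matched syntactically: unification would unfold [Cplus] and the
   real numbers. *)
Ltac cts := repeat first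
  [ assumption
  | lazymatch goal with
    | |- continuous (fun x => x) _ => apply continuous_id
    | |- continuous (fun _ => ?c) _ => apply continuous_const
    | |- continuous (fun x => Cplus _ _) _ => apply continuous_Cplus
    | |- continuous (fun x => Cminus _ _) _ => apply continuous_Cminus
    | |- continuous (fun x => Cmult _ _) _ => apply continuous_Cmult
    | |- continuous (fun x => RtoC _) _ => apply continuous_RtoC
    | |- continuous (fun x => cis _) _ => apply continuous_cis
    | |- continuous (fun x => Cmod _) _ => apply continuous_Cmod
    | |- continuous (fun x => Rplus _ _) _ => apply continuous_Rplus
    | |- continuous (fun x => Rminus _ _) _ => apply continuous_Rminus
    | |- continuous (fun x => Rmult _ _) _ => apply continuous_Rmult
    | |- continuous (fun x => Ropp _) _ => apply continuous_Ropp
    | |- continuous (fun x => Rmax _ _) _ => apply continuous_Rmax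
    | |- continuous (fun x => Rmin _ _) _ => apply continuous_Rmin
    | |- continuous (fun x => pair _ _) _ => apply continuous_pair
    | |- continuous fst ?p => destruct p; apply continuous_fst
    | |- continuous snd ?p => destruct p; apply continuous_snd
    | |- continuous (Rmult ?c) _ => apply (continuous_Rmult (fun _ => c) (fun x => x))
    | |- continuous (Rplus ?c) _ => apply (continuous_Rplus (fun _ => c) (fun x => x))
    | |- continuous (Rminus ?c) _ => apply (continuous_Rminus (fun _ => c) (fun x => x))
    | |- continuous RtoC _ => apply (continuous_RtoC (fun x => x))
    | |- continuous Cmod _ => apply (continuous_Cmod (fun x => x))
    | |- continuous (Cmult ?c) _ => apply (continuous_Cmult (fun _ => c) (fun x => x))
    | |- continuous (fun x => fst _) _ => apply continuous_pfst
    | |- continuous (fun x => snd _) _ => apply continuous_psnd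
    end ].

(** Retraction of the line onto [0, 1]. Composing with it makes a map that is continuous on [I01]
    continuous everywhere, so that later continuity claims carry no domain. *)
Definition clamp (t : R) : R := Rmax 0 (Rmin 1 t).

Lemma clamp_I t : I01 (clamp t).
Proof. unfold clamp, I01, Rmax, Rmin; repeat destruct Rle_dec; lra. Qed.

Lemma clamp_id t : I01 t -> clamp t = t.
Proof. unfold clamp, I01, Rmax, Rmin; repeat destruct Rle_dec; lra. Qed.

Lemma clamp_1 r : 1 <= r -> clamp r = 1.
Proof. unfold clamp, Rmax, Rmin; repeat destruct Rle_dec; lra. Qed.

Lemma clamp_0 r : r <= 0 -> clamp r = 0.
Proof. unfold clamp, Rmax, Rmin; repeat destruct Rle_dec; lra. Qed.

Lemma continuous_clamp {T : UniformSpace} (f : T -> R) p :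
  continuous f p -> continuous (fun x => clamp (f x)) p.
Proof. intros Hf; unfold clamp; cts. Qed.

Lemma continuous_on_comp {T U V : UniformSpace} (S : U -> Prop) (F : U -> V) (G : T -> U) p :
  continuous G p -> (forall q, S (G q)) -> continuous_on S F ->
  continuous (fun x => F (G x)) p.
Proof.
  intros HG HS HF.
  apply (filterlim_comp _ _ _ G F _ (within S (locally (G p)))); [|apply HF, HS].
  intros P HP; unfold filtermap.
  specialize (HG (fun y => S y -> P y) HP); unfold filtermap in HG.
  revert HG; apply filter_imp; auto.
Qed.

Lemma continuous_on_of {U V : UniformSpace} (S : U -> Prop) (F : U -> V) :
  (forall p, continuous F p) -> continuous_on S F.
Proof.
  intros HF p _ P HP; generalize (HF p P HP); unfold filtermap, within.
  apply filter_imp; auto.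
Qed.

Lemma continuous_on_subset {U V : UniformSpace} (S S' : U -> Prop) (F : U -> V) :
  (forall p, S p -> S' p) -> continuous_on S' F -> continuous_on S F.
Proof.
  intros HS HF p Hp P HP; generalize (HF p (HS p Hp) P HP); unfold filtermap, within.
  apply filter_imp; auto.
Qed.

Lemma continuous_on_ext_in {U V : UniformSpace} (S : U -> Prop) (F G : U -> V) :
  (forall p, S p -> F p = G p) -> continuous_on S F -> continuous_on S G.
Proof.
  intros HFG HF p Hp; rewrite <- (HFG p Hp).
  intros P HP; specialize (HF p Hp P HP); unfold filtermap, within in *.
  revert HF; apply filter_imp; intros x Hx Sx; rewrite <- HFG; auto.
Qed.

(** * Paths up to homotopy in a region of the plane *)

Definition path (U : C -> Prop) (a : R -> C) : Prop :=
  continuous_on I01 a /\ forall t, I01 t -> U (a t).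

(** Unlike in [homotopic], the homotopy is continuous on the whole plane, and the end points are
    arbitrary, so that loops can be cut into pieces. For loops at [u0], [homotopic_hom] and
    [hom_homotopic] pass between the two notions. *)
Definition hom (U : C -> Prop) (a b : R -> C) : Prop :=
  exists H : R * R -> C,
    (forall p, continuous H p) /\
    (forall s t, I01 s -> I01 t -> U (H (s, t))) /\
    (forall t, I01 t -> H (0, t) = a t /\ H (1, t) = b t) /\
    (forall s, I01 s -> H (s, 0) = a 0 /\ H (s, 1) = a 1).

Lemma I01_0 : I01 0. Proof. unfold I01; lra. Qed.
Lemma I01_1 : I01 1. Proof. unfold I01; lra. Qed.
#[local] Hint Resolve I01_0 I01_1 clamp_I : core.

Lemma continuous_extension (a : R -> C) :
  continuous_on I01 a -> forall t, continuous (fun t => a (clamp t)) t.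
Proof.
  intros Ha t; apply (continuous_on_comp I01 a clamp); auto.
  apply (continuous_clamp (fun x => x)); cts.
Qed.

Lemma continuous_extension_comp {T : UniformSpace} (a : R -> C) (f : T -> R) p :
  continuous_on I01 a -> continuous f p -> continuous (fun x => a (clamp (f x))) p.
Proof.
  intros Ha Hf; apply (continuous_comp f (fun t => a (clamp t))); trivial.
  now apply continuous_extension.
Qed.

Lemma hom_path_l U a b : hom U a b -> path U a.
Proof.
  intros (H & Hc & HU & Hab & _); split.
  - apply continuous_on_ext_in with (fun t => H (0, t)); [now intros t Ht; apply Hab|].
    apply continuous_on_of; intros t; apply (continuous_comp (fun t => (0, t)) H); [cts | apply Hc].
  - intros t Ht; destruct (Hab t Ht) as [<- _]; auto.
Qed.

Lemma hom_ends U a b : hom U a b -> a 0 = b 0 /\ a 1 = b 1.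
Proof.
  intros (H & _ & _ & Hab & He).
  destruct (Hab 0 I01_0) as [_ e0], (Hab 1 I01_1) as [_ e1], (He 1 I01_1) as [e2 e3].
  split; congruence.
Qed.

Lemma hom_sym U a b : hom U a b -> hom U b a.
Proof.
  intros h; destruct (hom_ends _ _ _ h) as [h0 h1]; destruct h as (H & Hc & HU & Hab & He).
  exists (fun p => H (1 - fst p, snd p)); split; [|split; [|split]]; simpl.
  - intros p; apply (continuous_comp (fun p => (1 - fst p, snd p)) H); [cts | apply Hc].
  - intros s t [? ?] Ht; apply HU; trivial; split; lra.
  - intros t Ht; replace (1 - 1) with 0 by ring; rewrite Rminus_0_r.
    destruct (Hab t Ht); auto.
  - intros s [? ?]; rewrite <- h0, <- h1; apply He; split; lra.
Qed.

Lemma hom_path_r U a b : hom U a b -> path U b.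
Proof. intros h; apply (hom_path_l U b a), hom_sym, h. Qed.

(** The two homotopies are glued by a sum instead of a case distinction: outside its own half each
    summand is clamped to the common middle path, and the last term subtracts that path. Continuity
    is then immediate. The same device serves for products of paths. *)
Lemma hom_trans U a b c : hom U a b -> hom U b c -> hom U a c.
Proof.
  intros h1 h2; destruct (hom_ends _ _ _ h1) as [e0 e1].
  destruct h1 as (H & Hc & HU & Hab & He), h2 as (H' & Hc' & HU' & Hab' & He').
  assert (HH : forall s t, I01 s -> I01 t ->
    (H (clamp (2 * s), t) + H' (clamp (2 * s - 1), t) - H (1, t))%C =
    if Rle_dec s (1 / 2) then H (2 * s, t) else H' (2 * s - 1, t)).
  { intros s t [? ?] Ht; destruct (Hab t Ht) as [_ Hb], (Hab' t Ht) as [Hb' _].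
    destruct Rle_dec.
    - rewrite (clamp_0 (2 * s - 1)), clamp_id by (try split; lra); rewrite Hb, Hb'; ring.
    - rewrite (clamp_1 (2 * s)), clamp_id by (try split; lra); ring. }
  exists (fun p => (H (clamp (2 * fst p), snd p) + H' (clamp (2 * fst p - 1), snd p)
                    - H (1, snd p))%C).
  split; [|split; [|split]]; simpl.
  - intros p; apply continuous_Cminus; [apply continuous_Cplus|].
    + apply (continuous_comp (fun p => (clamp (2 * fst p), snd p)) H); [|apply Hc].
      apply continuous_pair; [apply continuous_clamp|]; cts.
    + apply (continuous_comp (fun p => (clamp (2 * fst p - 1), snd p)) H'); [|apply Hc'].
      apply continuous_pair; [apply continuous_clamp|]; cts.
    + apply (continuous_comp (fun p => (1, snd p)) H); [cts | apply Hc].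
  - intros s t Hs Ht; rewrite HH by trivial; destruct Hs.
    destruct Rle_dec; [apply HU | apply HU']; trivial; split; lra.
  - intros t Ht; rewrite !HH by auto.
    destruct (Rle_dec 0 _), (Rle_dec 1 _); try lra.
    rewrite Rmult_0_r; replace (2 * 1 - 1) with 1 by ring; split; [now apply Hab | now apply Hab'].
  - intros s Hs; rewrite !HH by auto; destruct Hs.
    destruct Rle_dec; [apply He; split; lra|].
    rewrite e0, e1; apply He'; split; lra.
Qed.

Lemma hom_ext U a b : path U a -> (forall t, I01 t -> a t = b t) -> hom U a b.
Proof.
  intros [Hc HU] Hab; exists (fun p => a (clamp (snd p))); split; [|split; [|split]]; simpl.
  - intros p; apply continuous_extension_comp; [trivial | cts].
  - intros s t _ Ht; auto.
  - intros t Ht; rewrite clamp_id by trivial; auto.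
  - intros s _; now rewrite !clamp_id by auto.
Qed.

Lemma hom_refl U a : path U a -> hom U a a.
Proof. intros Ha; now apply hom_ext. Qed.

Lemma hom_mono (U V : C -> Prop) a b : (forall y, U y -> V y) -> hom U a b -> hom V a b.
Proof. intros HUV (H & Hc & HU & Hr); exists H; split; [trivial | split; auto]. Qed.

Lemma hom_straight U a b : path U a -> path U b -> a 0 = b 0 -> a 1 = b 1 ->
  (forall s t, I01 s -> I01 t -> U (a t + RtoC s * (b t - a t))%C) -> hom U a b.
Proof.
  intros [Hca HUa] [Hcb HUb] e0 e1 HU.
  exists (fun p => a (clamp (snd p)) + RtoC (fst p) * (b (clamp (snd p)) - a (clamp (snd p))))%C.
  split; [|split; [|split]]; simpl.
  - intros p; cts; apply continuous_extension_comp; trivial; cts.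
  - intros s t Hs Ht; rewrite clamp_id by trivial; auto.
  - intros t Ht; rewrite clamp_id by trivial; split; ring.
  - intros s Hs; rewrite !clamp_id, <- e0, <- e1 by auto; split; ring.
Qed.

Lemma hom_reparam U a (f g : R -> R) : path U a ->
  (forall t, continuous f t) -> (forall t, continuous g t) ->
  (forall t, I01 t -> I01 (f t)) -> (forall t, I01 t -> I01 (g t)) ->
  f 0 = g 0 -> f 1 = g 1 -> hom U (fun t => a (f t)) (fun t => a (g t)).
Proof.
  intros [Hc HU] Hf Hg If Ig e0 e1.
  assert (Hi : forall s t, I01 s -> I01 t -> I01 (f t + s * (g t - f t))).
  { intros s t [? ?] Ht; destruct (If t Ht), (Ig t Ht); split; nra. }
  exists (fun p => a (clamp (f (snd p) + fst p * (g (snd p) - f (snd p))))).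
  split; [|split; [|split]]; simpl.
  - intros p; apply continuous_extension_comp; trivial; cts;
      apply continuous_Rcomp; trivial; cts.
  - intros s t Hs Ht; rewrite clamp_id; auto.
  - intros t Ht; rewrite !clamp_id by auto; split; f_equal; ring.
  - intros s Hs; rewrite !clamp_id by auto; rewrite <- e0, <- e1; split; f_equal; ring.
Qed.

Lemma path_reparam U a (f : R -> R) : path U a -> (forall t, continuous f t) ->
  (forall t, I01 t -> I01 (f t)) -> path U (fun t => a (f t)).
Proof. intros Ha Hf If; eapply hom_path_l, hom_reparam; eauto. Qed.

Lemma hom_map (U V : C -> Prop) F a b : continuous_on U F -> (forall y, U y -> V (F y)) ->
  hom U a b -> hom V (fun t => F (a t)) (fun t => F (b t)).
Proof.
  intros HF HUV (H & Hc & HU & Hab & He).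
  exists (fun p => F (H (clamp (fst p), clamp (snd p)))).
  split; [|split; [|split]]; simpl.
  - intros p; apply (continuous_on_comp U F (fun p => H (clamp (fst p), clamp (snd p)))); auto.
    apply (continuous_comp (fun p => (clamp (fst p), clamp (snd p))) H); [|apply Hc].
    apply continuous_pair; apply continuous_clamp; cts.
  - intros s t Hs Ht; auto.
  - intros t Ht; rewrite !clamp_id by auto; destruct (Hab t Ht) as [-> ->]; auto.
  - intros s Hs; rewrite !clamp_id by auto; destruct (He s Hs) as [-> ->]; auto.
Qed.

Lemma path_map (U V : C -> Prop) F a : continuous_on U F -> (forall y, U y -> V (F y)) ->
  path U a -> path V (fun t => F (a t)).
Proof. intros HF HUV Ha; eapply hom_path_l, hom_map; eauto using hom_refl. Qed.

(** * The groupoid laws *)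

Lemma lmul_clamp a b t : a 1 = b 0 -> I01 t ->
  (a (clamp (2 * t)) + b (clamp (2 * t - 1)) - b 0)%C = lmul a b t.
Proof.
  intros e [? ?]; unfold lmul; destruct Rle_dec.
  - rewrite (clamp_0 (2 * t - 1)), clamp_id by (try split; lra); ring.
  - rewrite (clamp_1 (2 * t)), clamp_id, e by (try split; lra); ring.
Qed.

Lemma lmul_0 a b : lmul a b 0 = a 0.
Proof. unfold lmul; destruct Rle_dec; [f_equal|]; lra. Qed.

Lemma lmul_1 a b : lmul a b 1 = b 1.
Proof. unfold lmul; destruct Rle_dec; [|f_equal]; lra. Qed.

Lemma lmul_in (U : C -> Prop) a b t : (forall t, I01 t -> U (a t)) ->
  (forall t, I01 t -> U (b t)) -> I01 t -> U (lmul a b t).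
Proof. intros Ha Hb [? ?]; unfold lmul; destruct Rle_dec; [apply Ha | apply Hb]; split; lra. Qed.

Lemma hom_mul U a a' b b' : hom U a a' -> hom U b b' -> a 1 = b 0 ->
  hom U (lmul a b) (lmul a' b').
Proof.
  intros h h' e; destruct (hom_ends _ _ _ h) as [e0 e1], (hom_ends _ _ _ h') as [e0' e1'].
  destruct h as (H & Hc & HU & Hab & He), h' as (H' & Hc' & HU' & Hab' & He').
  assert (HH : forall s t, I01 s -> I01 t ->
    (H (s, clamp (2 * t)) + H' (s, clamp (2 * t - 1)) - b 0)%C =
    lmul (fun t => H (s, t)) (fun t => H' (s, t)) t).
  { intros s t Hs Ht; rewrite <- lmul_clamp; trivial.
    - now destruct (He' s Hs) as [-> _].
    - now destruct (He' s Hs) as [-> _], (He s Hs) as [_ ->]. }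
  exists (fun p => (H (fst p, clamp (2 * snd p)) + H' (fst p, clamp (2 * snd p - 1)) - b 0)%C).
  split; [|split; [|split]]; simpl.
  - intros p; apply continuous_Cminus; [apply continuous_Cplus | cts].
    + apply (continuous_comp (fun p => (fst p, clamp (2 * snd p))) H); [|apply Hc].
      apply continuous_pair; [|apply continuous_clamp]; cts.
    + apply (continuous_comp (fun p => (fst p, clamp (2 * snd p - 1))) H'); [|apply Hc'].
      apply continuous_pair; [|apply continuous_clamp]; cts.
  - intros s t Hs Ht; rewrite HH by trivial; apply lmul_in; auto.
  - intros t [? ?]; rewrite !HH by (auto; split; trivial).
    unfold lmul; destruct Rle_dec; [apply Hab | apply Hab']; split; lra.
  - intros s Hs; rewrite !HH by auto; rewrite !lmul_0, !lmul_1.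
    split; [now apply He | now apply He'].
Qed.

Lemma path_mul U a b : path U a -> path U b -> a 1 = b 0 -> path U (lmul a b).
Proof. intros Ha Hb e; eapply hom_path_l, hom_mul; eauto using hom_refl. Qed.

Lemma hom_inv U a b : hom U a b -> hom U (linv a) (linv b).
Proof.
  intros (H & Hc & HU & Hab & He).
  assert (HI : forall t, I01 t -> I01 (1 - t)) by (unfold I01; intros; lra).
  exists (fun p => H (fst p, 1 - snd p)); split; [|split; [|split]]; simpl.
  - intros p; apply (continuous_comp (fun p => (fst p, 1 - snd p)) H); [cts | apply Hc].
  - auto.
  - intros t Ht; unfold linv; auto.
  - intros s Hs; unfold linv; rewrite Rminus_0_r; replace (1 - 1) with 0 by ring.
    destruct (He s Hs); auto.
Qed.

Lemma path_inv U a : path U a -> path U (linv a).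
Proof. intros Ha; eapply hom_path_l, hom_inv, hom_refl, Ha. Qed.

Ltac minmax := unfold Rmin, Rmax, I01 in *; repeat destruct Rle_dec; try lra.

Lemma hom_assoc U a b c : path U a -> path U b -> path U c -> a 1 = b 0 -> b 1 = c 0 ->
  hom U (lmul (lmul a b) c) (lmul a (lmul b c)).
Proof.
  intros Ha Hb Hc e e'; set (d := lmul a (lmul b c)).
  assert (Hd : path U d).
  { apply path_mul; trivial; [apply path_mul; trivial | now rewrite lmul_0]. }
  (* The change of parameter that carries the break points 1/4, 1/2 to 1/2, 3/4; being concave and
     piecewise affine, it is the minimum of its affine pieces. *)
  set (f := fun t => Rmin (2 * t) (Rmin (t + 1 / 4) (t / 2 + 1 / 2))).
  apply hom_trans with (fun t => d (f t)).
  - apply hom_sym, hom_ext.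
    + apply (path_reparam U d f); trivial;
        try (intros t; unfold f, Rdiv; cts); unfold f; minmax.
    + intros t Ht; unfold f, d, lmul; minmax; f_equal; lra.
  - apply (hom_reparam U d f (fun t => t)); trivial;
      try (intros t; unfold f, Rdiv; cts); unfold f; minmax.
Qed.

Lemma hom_unit_r U a c : path U a -> (forall t, c t = a 1) -> hom U (lmul a c) a.
Proof.
  intros Ha Hc; set (f := fun t => Rmin (2 * t) 1).
  apply hom_trans with (fun t => a (f t)).
  - apply hom_sym, hom_ext.
    + apply (path_reparam U a f); trivial;
        try (intros t; unfold f; cts); unfold f; minmax.
    + intros t Ht; unfold f, lmul; rewrite Hc; minmax; f_equal; lra.
  - apply (hom_reparam U a f (fun t => t)); trivial;
      try (intros t; unfold f; cts); unfold f; minmax.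
Qed.

Lemma hom_unit_l U a c : path U a -> (forall t, c t = a 0) -> hom U (lmul c a) a.
Proof.
  intros Ha Hc; set (f := fun t => Rmax 0 (2 * t - 1)).
  apply hom_trans with (fun t => a (f t)).
  - apply hom_sym, hom_ext.
    + apply (path_reparam U a f); trivial;
        try (intros t; unfold f; cts); unfold f; minmax.
    + intros t Ht; unfold f, lmul; rewrite Hc; minmax; f_equal; lra.
  - apply (hom_reparam U a f (fun t => t)); trivial;
      try (intros t; unfold f; cts); unfold f; minmax.
Qed.

Lemma hom_inv_r U a c : path U a -> (forall t, c t = a 0) -> hom U (lmul a (linv a)) c.
Proof.
  intros Ha Hc; set (f := fun t => Rmin (2 * t) (2 - 2 * t)).
  apply hom_trans with (fun t => a (f t)); [|apply hom_trans with (fun t => a ((fun _ => 0) t))].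
  - apply hom_sym, hom_ext.
    + apply (path_reparam U a f); trivial;
        try (intros t; unfold f; cts); unfold f; minmax.
    + intros t Ht; unfold f, lmul, linv; minmax; f_equal; lra.
  - apply (hom_reparam U a f (fun _ => 0)); trivial;
      try (intros t; unfold f; cts); unfold f; minmax.
  - apply hom_ext; [|auto]; split; [apply continuous_on_of; intros; cts|].
    intros; apply Ha; auto.
Qed.

Lemma linv_linv a t : linv (linv a) t = a t.
Proof. unfold linv; f_equal; ring. Qed.

Lemma hom_inv_l U a c : path U a -> (forall t, c t = a 1) -> hom U (lmul (linv a) a) c.
Proof.
  intros Ha Hc; pose proof (path_inv _ _ Ha) as Hi.
  apply hom_trans with (lmul (linv a) (linv (linv a))).
  - apply hom_mul; [now apply hom_refl | | unfold linv; f_equal; ring].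
    apply hom_ext; trivial; intros; now rewrite linv_linv.
  - apply hom_inv_r; trivial; intros t; rewrite Hc; unfold linv; f_equal; ring.
Qed.

Lemma hom_linv_mul U a b : path U a -> path U b -> a 1 = b 0 ->
  hom U (linv (lmul a b)) (lmul (linv b) (linv a)).
Proof.
  intros Ha Hb e; apply hom_ext; [now apply path_inv, path_mul|].
  intros t _; unfold linv, lmul.
  destruct (Rle_dec (1 - t) _), (Rle_dec t _).
  - replace (2 * (1 - t)) with 1 by lra; replace (1 - 2 * t) with 0 by lra; auto.
  - f_equal; ring.
  - f_equal; ring.
  - lra.
Qed.

(** Insert [linv b] followed by [b] after [a] and reassociate. This reduces comparing two paths to
    contracting one loop, which is what [zhom] tests. *)
Lemma hom_of_null U a b c : path U a -> path U b -> a 0 = b 0 -> a 1 = b 1 ->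
  (forall t, c t = a 0) -> hom U (lmul a (linv b)) c -> hom U a b.
Proof.
  intros Ha Hb e0 e1 Hc h; pose proof (path_inv _ _ Hb) as Hi.
  assert (i0 : linv b 0 = b 1) by (unfold linv; f_equal; ring).
  assert (i1 : linv b 1 = b 0) by (unfold linv; f_equal; ring).
  apply hom_trans with (lmul a (fun _ => a 1)); [now apply hom_sym, hom_unit_r|].
  apply hom_trans with (lmul a (lmul (linv b) b)).
  { apply hom_mul; [now apply hom_refl | | trivial].
    apply hom_sym, hom_inv_l; trivial. }
  apply hom_trans with (lmul (lmul a (linv b)) b).
  { apply hom_sym, hom_assoc; trivial; congruence. }
  apply hom_trans with (lmul c b).
  - apply hom_mul; [trivial | now apply hom_refl | now rewrite lmul_1].
  - apply hom_unit_l; trivial; congruence.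
Qed.

(** * Polygonal paths *)

Definition seg (p q : C) (t : R) : C := (p + RtoC t * (q - p))%C.

Fixpoint pl (p : C) (l : list C) : R -> C :=
  match l with
  | [] => fun _ => p
  | q :: l' => lmul (seg p q) (pl q l')
  end.

Fixpoint endpt {T : Type} (p : T) (l : list T) : T :=
  match l with [] => p | q :: l' => endpt q l' end.

Definition seg_in (U : C -> Prop) (p q : C) : Prop := forall t, I01 t -> U (seg p q t).

Definition tri_in (U : C -> Prop) (p q r : C) : Prop :=
  forall s t, 0 <= s -> 0 <= t -> s + t <= 1 ->
    U (p + RtoC s * (q - p) + RtoC t * (r - p))%C.

Fixpoint edges (U : C -> Prop) (p : C) (l : list C) : Prop :=
  match l with
  | [] => U p
  | q :: l' => seg_in U p q /\ edges U q l'
  end.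

Lemma seg_0 p q : seg p q 0 = p.
Proof. unfold seg; ring. Qed.

Lemma seg_1 p q : seg p q 1 = q.
Proof. unfold seg; ring. Qed.

Lemma path_seg U p q : seg_in U p q -> path U (seg p q).
Proof. intros H; split; trivial; apply continuous_on_of; intros t; unfold seg; cts. Qed.

Lemma seg_in_sym U p q : seg_in U p q -> seg_in U q p.
Proof.
  intros H t [? ?]; replace (seg q p t) with (seg p q (1 - t)); [apply H; split; lra|].
  unfold seg; rewrite RtoC_minus; ring.
Qed.

Lemma hom_linv_seg U p q : seg_in U p q -> hom U (linv (seg p q)) (seg q p).
Proof.
  intros H; apply hom_ext; [now apply path_inv, path_seg|].
  intros t _; unfold linv, seg; rewrite RtoC_minus; ring.
Qed.

Lemma tri_in_seg U p q r : tri_in U p q r -> seg_in U p q /\ seg_in U q r /\ seg_in U p r.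
Proof.
  intros H; repeat split; intros t [? ?].
  - replace (seg p q t) with (p + RtoC t * (q - p) + RtoC 0 * (r - p))%C
      by (unfold seg; ring); apply H; lra.
  - replace (seg q r t) with (p + RtoC (1 - t) * (q - p) + RtoC t * (r - p))%C
      by (unfold seg; rewrite RtoC_minus; ring); apply H; lra.
  - replace (seg p r t) with (p + RtoC 0 * (q - p) + RtoC t * (r - p))%C
      by (unfold seg; ring); apply H; lra.
Qed.

(** The straight homotopy from two sides to the third stays in the filled triangle; the two
    replacements below give its affine coordinates on each half of the parameter interval. *)
Lemma hom_tri U p q r : tri_in U p q r -> hom U (lmul (seg p q) (seg q r)) (seg p r).
Proof.
  intros H; destruct (tri_in_seg _ _ _ _ H) as (Hpq & Hqr & Hpr).
  apply hom_straight.
  - apply path_mul; try now apply path_seg. now rewrite seg_0, seg_1.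
  - now apply path_seg.
  - now rewrite lmul_0, !seg_0.
  - now rewrite lmul_1, !seg_1.
  - intros s t [? ?] [? ?]; unfold lmul; destruct Rle_dec.
    + replace (_ + _)%C with
        (p + RtoC ((1 - s) * (2 * t)) * (q - p) + RtoC (s * t) * (r - p))%C
        by (unfold seg; rewrite !RtoC_mult, RtoC_minus; ring).
      apply H; nra.
    + replace (_ + _)%C with
        (p + RtoC ((1 - s) * (2 - 2 * t)) * (q - p)
         + RtoC ((1 - s) * (2 * t - 1) + s * t) * (r - p))%C
        by (unfold seg; rewrite !RtoC_plus, !RtoC_mult, !RtoC_minus, !RtoC_mult; ring).
      apply H; nra.
Qed.

Lemma pl_0 p l : pl p l 0 = p.
Proof. destruct l; simpl; [trivial | now rewrite lmul_0, seg_0]. Qed.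

Lemma pl_1 p l : pl p l 1 = endpt p l.
Proof. revert p; induction l; intros p; simpl; [trivial | now rewrite lmul_1]. Qed.

Lemma path_pl U p l : edges U p l -> path U (pl p l).
Proof.
  revert p; induction l as [|q l IH]; intros p H; simpl in *.
  - split; [apply continuous_on_of; intros; cts | trivial].
  - apply path_mul; [now apply path_seg | now apply IH | now rewrite seg_1, pl_0].
Qed.

Lemma edges_start U p l : edges U p l -> U p.
Proof. destruct l; simpl; [trivial|]. intros [H _]; rewrite <- (seg_0 p c); auto. Qed.

Lemma edges_app U p l l' : edges U p (l ++ l') <-> edges U p l /\ edges U (endpt p l) l'.
Proof.
  revert p; induction l as [|q l IH]; intros p; simpl.
  - pose proof (edges_start U p l'); tauto.
  - rewrite IH; tauto.
Qed.

Lemma endpt_app {T : Type} (p : T) l l' : endpt p (l ++ l') = endpt (endpt p l) l'.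
Proof. revert p; induction l; simpl; auto. Qed.

Lemma pl_app U p l l' : edges U p (l ++ l') ->
  hom U (pl p (l ++ l')) (lmul (pl p l) (pl (endpt p l) l')).
Proof.
  revert p; induction l as [|q l IH]; intros p H; simpl in *.
  - apply hom_sym, hom_unit_l; [now apply path_pl | intros; now rewrite pl_0].
  - destruct H as [Hs H]; pose proof (proj1 (edges_app _ _ _ _) H) as [H1 H2].
    eapply hom_trans; [apply hom_mul; [apply hom_refl, path_seg, Hs | apply IH, H |]|].
    + now rewrite seg_1, pl_0.
    + apply hom_sym, hom_assoc;
        [now apply path_seg | now apply path_pl | now apply path_pl | |];
        now rewrite ?seg_1, ?pl_0, ?pl_1.
Qed.

Lemma edges_rev U p l q : edges U p (l ++ [q]) -> edges U q (rev l ++ [p]).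
Proof.
  revert p; induction l as [|v l IH]; intros p; simpl.
  - intros [H Hq]; split; [now apply seg_in_sym|]. rewrite <- (seg_0 p q); auto.
  - intros [H Hl]; rewrite edges_app; rewrite endpt_app; simpl; split; [now apply IH|].
    split; [now apply seg_in_sym|]. rewrite <- (seg_0 p v); auto.
Qed.

Lemma pl_rev U p l q : edges U p (l ++ [q]) ->
  hom U (linv (pl p (l ++ [q]))) (pl q (rev l ++ [p])).
Proof.
  revert p; induction l as [|v l IH]; intros p H.
  - simpl in *; destruct H as [H Hq].
    apply hom_trans with (linv (seg p q)).
    + apply hom_inv, hom_unit_r; [now apply path_seg | intros; now rewrite seg_1].
    + eapply hom_trans; [now apply hom_linv_seg|].
      apply hom_sym, hom_unit_r; [now apply path_seg, seg_in_sym | intros; now rewrite seg_1].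
  - pose proof (edges_rev _ _ _ _ H) as Hr; simpl in H, Hr |- *; destruct H as [Hs H].
    eapply hom_trans; [apply hom_linv_mul; [now apply path_seg | now apply path_pl |]|].
    { now rewrite seg_1, pl_0. }
    apply hom_trans with (lmul (pl q (rev l ++ [v])) (pl v [p])).
    + apply hom_mul; [now apply IH | |].
      * eapply hom_trans; [now apply hom_linv_seg|].
        apply hom_sym, hom_unit_r; [now apply path_seg, seg_in_sym | intros; now rewrite seg_1].
      * unfold linv; replace (1 - 1) with 0 by ring; replace (1 - 0) with 1 by ring.
        now rewrite pl_0, seg_1.
    + pose proof (pl_app _ _ _ _ Hr) as E; rewrite endpt_app in E; now apply hom_sym.
Qed.

Lemma pl_delete U p v w l : tri_in U p v w -> edges U w l ->
  hom U (pl p (v :: w :: l)) (pl p (w :: l)).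
Proof.
  intros Ht Hl; destruct (tri_in_seg _ _ _ _ Ht) as (Hpv & Hvw & Hpw); simpl.
  eapply hom_trans; [apply hom_sym, hom_assoc; try (now apply path_seg); try (now apply path_pl)|].
  - now rewrite seg_1, seg_0.
  - now rewrite seg_1, pl_0.
  - apply hom_mul; [now apply hom_tri | now apply hom_refl, path_pl |].
    now rewrite lmul_1, seg_1, pl_0.
Qed.

(** * Obstacles with integer coordinates *)

Definition zpt : Type := (Z * Z)%type.

(** The unit of length is 20. *)
Definition toC (v : zpt) : C := (IZR (fst v) / 20, IZR (snd v) / 20).

Definition dot (n y : C) : R := fst n * fst y + snd n * snd y.

(** Convex hull, as an intersection of open half-planes. *)
Definition in_hull (h : list zpt) (y : C) : Prop :=
  forall n c, (forall v, In v h -> dot n (toC v) < c) -> dot n y < c.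

(** An obstacle is a list of vertices: a single one for a puncture, several for a region that
    contains the path of a moving point. *)
Definition clear (obs : list (list zpt)) (y : C) : Prop :=
  D y /\ forall h, In h obs -> ~ in_hull h y.

Definition zdot (n a b : zpt) : Z := (fst n * (fst a - fst b) + snd n * (snd a - snd b))%Z.

Definition zsep (n : zpt) (A B : list zpt) : bool :=
  forallb (fun a => forallb (fun b => (0 <? zdot n a b)%Z) B) A.

(** Two disjoint convex polygons are separated by a line orthogonal or parallel
    to a segment joining two vertices. *)
Definition zdirs (P : list zpt) : list zpt :=
  flat_map (fun u => flat_map (fun v =>
    let d := (fst v - fst u, snd v - snd u)%Z in [d; (- snd d, fst d)%Z]) P) P.

(** 6400 is the square of 80, the radius 4 at the scale 20. *)
Definition zin_disk (a : zpt) : bool := (fst a * fst a + snd a * snd a <=? 6400)%Z.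

(** Only vertices are examined: membership in the disk and strict separation by a line both pass to
    convex hulls, which is how [zclear_seg] and [zclear_tri] conclude. *)
Definition zclear (obs : list (list zpt)) (A : list zpt) : bool :=
  forallb zin_disk A &&
  forallb (fun h => existsb (fun n => zsep n A h) (zdirs (A ++ h))) obs.

Lemma Cmod_convex r y z t : Cmod y <= r -> Cmod z <= r -> I01 t ->
  Cmod (y + RtoC t * (z - y)) <= r.
Proof.
  intros Hy Hz [? ?].
  replace (_ + _)%C with (RtoC (1 - t) * y + RtoC t * z)%C by (rewrite RtoC_minus; ring).
  eapply Rle_trans; [apply Cmod_triangle|].
  rewrite !Cmod_mult, !Cmod_R, !Rabs_pos_eq by lra; nra.
Qed.

Lemma D_convex y z t : D y -> D z -> I01 t -> D (y + RtoC t * (z - y))%C.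
Proof. apply Cmod_convex. Qed.

Lemma D_sqr y : fst y * fst y + snd y * snd y <= 16 -> D y.
Proof.
  intros H; unfold D, Cmod; replace 4 with (sqrt (4 * 4)) by (apply sqrt_square; lra).
  apply sqrt_le_1_alt; simpl; lra.
Qed.

Lemma zin_disk_D a : zin_disk a = true -> D (toC a).
Proof.
  unfold zin_disk; intros H; apply Z.leb_le, IZR_le in H.
  rewrite plus_IZR, !mult_IZR in H; apply D_sqr; simpl; lra.
Qed.

Lemma dot_lin n y z t : dot n (y + RtoC t * (z - y))%C = dot n y + t * (dot n z - dot n y).
Proof. unfold dot; simpl; ring. Qed.

Lemma zdot_pos n a b : (0 <? zdot n a b)%Z = true -> dot (toC n) (toC b) < dot (toC n) (toC a).
Proof.
  intros H; apply Z.ltb_lt, IZR_lt in H; unfold zdot in H.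
  rewrite plus_IZR, !mult_IZR, !minus_IZR in H; unfold dot; simpl; lra.
Qed.

Lemma zsep_dot n A B a b : zsep n A B = true -> In a A -> In b B ->
  dot (toC n) (toC b) < dot (toC n) (toC a).
Proof.
  unfold zsep; intros H Ha Hb; rewrite forallb_forall in H.
  specialize (H a Ha); rewrite forallb_forall in H; apply zdot_pos, H, Hb.
Qed.

Lemma zclear_spec obs A : zclear obs A = true ->
  (forall a, In a A -> D (toC a)) /\
  (forall h, In h obs -> exists n, forall a v, In a A -> In v h -> dot n (toC v) < dot n (toC a)).
Proof.
  unfold zclear; rewrite Bool.andb_true_iff, !forallb_forall; intros [H1 H2]; split.
  - intros a Ha; now apply zin_disk_D, H1.
  - intros h Hh; specialize (H2 h Hh); apply existsb_exists in H2; destruct H2 as (n & _ & Hn).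
    exists (toC n); intros a v Ha Hv; eapply zsep_dot; eauto.
Qed.

Lemma clear_of_sep obs y : D y ->
  (forall h, In h obs -> exists n, forall v, In v h -> dot n (toC v) < dot n y) -> clear obs y.
Proof.
  intros HD Hs; split; trivial; intros h Hh Hi; destruct (Hs h Hh) as [n Hn].
  specialize (Hi n _ Hn); lra.
Qed.

Lemma Rlt_convex2 c x y t : I01 t -> c < x -> c < y -> c < x + t * (y - x).
Proof. intros [? ?] ? ?; destruct (Rle_dec x y); nra. Qed.

Lemma Rlt_convex3 c x y z p q r : 0 <= p -> 0 <= q -> 0 <= r -> p + q + r = 1 ->
  c < x -> c < y -> c < z -> c < p * x + q * y + r * z.
Proof.
  intros; set (m := Rmin x (Rmin y z)).
  assert (c < m /\ m <= x /\ m <= y /\ m <= z) as (? & ? & ? & ?)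
    by (unfold m, Rmin; repeat destruct Rle_dec; lra).
  apply Rlt_le_trans with (p * m + q * m + r * m); [|nra].
  now rewrite <- !Rmult_plus_distr_r, H2, Rmult_1_l.
Qed.

Lemma zclear_tri obs a b c : zclear obs [a; b; c] = true ->
  tri_in (clear obs) (toC a) (toC b) (toC c).
Proof.
  intros H; apply zclear_spec in H; destruct H as [H1 H2].
  intros s t Hs Ht Hst.
  assert (E : (toC a + RtoC s * (toC b - toC a) + RtoC t * (toC c - toC a) =
    RtoC (1 - s - t) * toC a + RtoC s * toC b + RtoC t * toC c)%C)
    by (rewrite !RtoC_minus; ring).
  apply clear_of_sep.
  - rewrite E; unfold D in *.
    eapply Rle_trans; [apply Cmod_triangle|].
    pose proof (Cmod_triangle (RtoC (1 - s - t) * toC a) (RtoC s * toC b)) as H.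
    rewrite !Cmod_mult, !Cmod_R, !Rabs_pos_eq in * by lra.
    pose proof (H1 a ltac:(simpl; auto)); pose proof (H1 b ltac:(simpl; auto));
      pose proof (H1 c ltac:(simpl; auto)); nra.
  - intros h Hh; destruct (H2 h Hh) as [n Hn]; exists n; intros v Hv.
    pose proof (Hn a v ltac:(simpl; auto) Hv); pose proof (Hn b v ltac:(simpl; auto) Hv);
      pose proof (Hn c v ltac:(simpl; auto) Hv).
    rewrite E; replace (dot n (_ + _ + _)%C) with
      ((1 - s - t) * dot n (toC a) + s * dot n (toC b) + t * dot n (toC c))
      by (unfold dot; simpl; ring).
    apply Rlt_convex3; lra.
Qed.

Lemma zclear_seg obs a b : zclear obs [a; b] = true -> seg_in (clear obs) (toC a) (toC b).
Proof.
  intros H; apply zclear_spec in H; destruct H as [H1 H2].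
  intros t Ht; apply clear_of_sep.
  - apply D_convex; trivial; apply H1; simpl; auto.
  - intros h Hh; destruct (H2 h Hh) as [n Hn]; exists n; intros v Hv.
    pose proof (Hn a v ltac:(simpl; auto) Hv); pose proof (Hn b v ltac:(simpl; auto) Hv).
    unfold seg; rewrite dot_lin; now apply Rlt_convex2.
Qed.

Lemma zclear_pt obs a : zclear obs [a] = true -> clear obs (toC a).
Proof.
  intros H; apply zclear_spec in H; destruct H as [H1 H2].
  apply clear_of_sep; [apply H1; simpl; auto|].
  intros h Hh; destruct (H2 h Hh) as [n Hn]; exists n; intros v Hv; apply Hn; simpl; auto.
Qed.

(** * Contraction of integer polygons by evaluation *)

Definition zpl (p : zpt) (l : list zpt) : R -> C := pl (toC p) (map toC l).

Fixpoint zedges (obs : list (list zpt)) (p : zpt) (l : list zpt) : bool :=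
  match l with
  | [] => zclear obs [p]
  | q :: l' => zclear obs [p; q] && zedges obs q l'
  end.

Lemma zedges_spec obs p l : zedges obs p l = true -> edges (clear obs) (toC p) (map toC l).
Proof.
  revert p; induction l as [|q l IH]; intros p; simpl.
  - apply zclear_pt.
  - rewrite Bool.andb_true_iff; intros [H1 H2]; split; [now apply zclear_seg | auto].
Qed.

(** A pass cuts off only the first removable vertex and never the last one, so [zhom] makes one pass
    per vertex before the closing one. Backtracking along an edge is removed as a degenerate
    triangle. *)
Fixpoint zdel (obs : list (list zpt)) (p : zpt) (l : list zpt) : list zpt :=
  match l with
  | v :: ((w :: _) as l') => if zclear obs [p; v; w] then l' else v :: zdel obs v l'
  | _ => l
  end.

Fixpoint zreduce (obs : list (list zpt)) (k : nat) (p : zpt) (l : list zpt) : list zpt :=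
  match k with O => l | S k' => zreduce obs k' p (zdel obs p l) end.

Lemma zdel_hom obs p l : edges (clear obs) (toC p) (map toC l) ->
  edges (clear obs) (toC p) (map toC (zdel obs p l)) /\
  hom (clear obs) (zpl p l) (zpl p (zdel obs p l)).
Proof.
  revert p; induction l as [|v l IH]; intros p H.
  - split; [exact H | now apply hom_refl, path_pl].
  - destruct l as [|w l]; [split; [exact H | now apply hom_refl, path_pl]|].
    assert (E : zdel obs p (v :: w :: l) =
      if zclear obs [p; v; w] then w :: l else v :: zdel obs v (w :: l)) by reflexivity.
    rewrite E; destruct (zclear obs [p; v; w]) eqn:T.
    + apply zclear_tri in T; destruct H as (_ & _ & H).
      split; [split; [now apply (tri_in_seg _ _ _ _ T) | exact H]|].
      now apply pl_delete.
    + destruct H as [H1 H2]; destruct (IH v H2) as [H3 H4]; split; [split; trivial|].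
      apply hom_mul; [now apply hom_refl, path_seg | exact H4 |].
      change (seg (toC p) (toC v) 1 = pl (toC v) (map toC (w :: l)) 0).
      now rewrite seg_1, pl_0.
Qed.

Lemma zreduce_hom obs k p l : edges (clear obs) (toC p) (map toC l) ->
  hom (clear obs) (zpl p l) (zpl p (zreduce obs k p l)).
Proof.
  revert l; induction k as [|k IH]; intros l H; simpl; [now apply hom_refl, path_pl|].
  destruct (zdel_hom _ _ _ H) as [H1 H2]; eapply hom_trans; eauto.
Qed.

Definition zloop (p : zpt) (l : list zpt) : R -> C := zpl p (l ++ [p]).

Definition is_nil {T : Type} (l : list T) : bool := match l with [] => true | _ => false end.

(** Tests whether the first loop followed by the inverse of the second one can be
    contracted by cutting off triangles that contain no obstacle. *)
Definition zhom (obs : list (list zpt)) (p : zpt) (l l' : list zpt) : bool :=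
  let c := l ++ [p] ++ rev l' in
  zedges obs p (l ++ [p]) && zedges obs p (l' ++ [p]) &&
  is_nil (removelast (zreduce obs (length c) p (c ++ [p]))).

Lemma zloop_app obs p l l' : zedges obs p (l ++ [p]) = true -> zedges obs p (l' ++ [p]) = true ->
  hom (clear obs) (lmul (zloop p l) (zloop p l')) (zloop p (l ++ [p] ++ l')).
Proof.
  intros H H'; apply zedges_spec in H, H'; unfold zloop, zpl.
  rewrite !app_assoc, <- app_assoc, (map_app _ (l ++ [p])).
  assert (E : endpt (toC p) (map toC (l ++ [p])) = toC p)
    by (rewrite map_app, endpt_app; reflexivity).
  rewrite <- E at 2; apply hom_sym, pl_app.
  rewrite edges_app, E; split; trivial.
Qed.

Lemma zdel_end obs p l : endpt p (zdel obs p l) = endpt p l.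
Proof.
  revert p; induction l as [|v [|w l] IH]; intros p; trivial.
  change (zdel obs p (v :: w :: l)) with
    (if zclear obs [p; v; w] then w :: l else v :: zdel obs v (w :: l)).
  destruct zclear; [reflexivity | apply (IH v)].
Qed.

Lemma zreduce_end obs k p l : endpt p (zreduce obs k p l) = endpt p l.
Proof. revert l; induction k; intros l; simpl; trivial. now rewrite IHk, zdel_end. Qed.

Lemma zhom_spec obs p l l' : zhom obs p l l' = true -> hom (clear obs) (zloop p l) (zloop p l').
Proof.
  unfold zhom; rewrite !Bool.andb_true_iff; intros [[H1 H2] H3].
  pose proof (zedges_spec _ _ _ H1) as E1; pose proof (zedges_spec _ _ _ H2) as E2.
  set (c := l ++ [p] ++ rev l') in *.
  assert (E : forall l, endpt (toC p) (map toC (l ++ [p])) = toC p)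
    by (intros; rewrite map_app, endpt_app; reflexivity).
  assert (E3 : edges (clear obs) (toC p) (map toC (c ++ [p]))).
  { unfold c; rewrite !app_assoc, <- (app_assoc (l ++ [p])), map_app, edges_app, E.
    split; trivial; rewrite map_app, map_rev; rewrite map_app in E2; now apply edges_rev. }
  apply hom_of_null with (fun _ => toC p);
    try (now apply path_pl); unfold zloop, zpl; rewrite ?pl_0, ?pl_1, ?E; trivial.
  eapply hom_trans with (zpl p (c ++ [p])).
  - unfold zpl, c; rewrite !app_assoc, <- (app_assoc (l ++ [p])).
    eapply hom_trans; [|apply hom_sym].
    2:{ rewrite (map_app _ (l ++ [p])); apply pl_app.
        rewrite <- map_app; unfold c in E3.
        now rewrite !app_assoc, <- (app_assoc (l ++ [p])) in E3. }
    rewrite E; apply hom_mul; [now apply hom_refl, path_pl | |].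
    + rewrite !map_app, map_rev; apply pl_rev; now rewrite map_app in E2.
    + unfold linv; rewrite Rminus_0_r, !pl_1, !E; trivial.
  - eapply hom_trans; [apply (zreduce_hom obs (length c)), E3|].
    pose proof (zreduce_end obs (length c) p (c ++ [p])) as He.
    rewrite endpt_app in He; simpl in He.
    pose proof (zreduce_hom obs (length c) p _ E3) as Hr; apply hom_path_r in Hr.
    (* The test leaves at most one vertex, and it is [p] because deletions keep the end point; the
       remaining path is constant. *)
    destruct (zreduce obs (length c) p (c ++ [p])) as [|q [|]]; simpl in *; try discriminate.
    + exact (hom_refl _ _ Hr).
    + subst q; apply hom_ext; [exact Hr|].
      intros t _; unfold zpl; cbn [map pl]; unfold lmul, seg; destruct Rle_dec; [ring | trivial].
Qed.

(** * Inscribed polygons *)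

Definition restr (a : R -> C) (u v t : R) : C := a (u + (v - u) * t).

Lemma hom_split U a u v w : path U a -> 0 <= u <= v -> v <= w <= 1 ->
  hom U (restr a u w) (lmul (restr a u v) (restr a v w)).
Proof.
  intros Ha Hu Hw; unfold restr.
  set (f := fun t => u + (w - u) * t).
  set (g := fun t => u + (v - u) * Rmin (2 * t) 1 + (w - v) * Rmax 0 (2 * t - 1)).
  assert (Hf : forall t, I01 t -> I01 (f t)) by (unfold f, I01; intros t [? ?]; split; nra).
  assert (Hg : forall t, I01 t -> I01 (g t)).
  { unfold g; intros t [? ?].
    assert (0 <= Rmin (2 * t) 1 <= 1) by minmax.
    assert (0 <= Rmax 0 (2 * t - 1) <= 1) by minmax.
    assert (0 <= (v - u) * Rmin (2 * t) 1 <= v - u) by nra.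
    assert (0 <= (w - v) * Rmax 0 (2 * t - 1) <= w - v) by nra.
    unfold I01; lra. }
  assert (h : hom U (fun t => a (f t)) (fun t => a (g t))).
  { apply hom_reparam; trivial; try (intros t; unfold f, g; cts);
      unfold f, g, Rmin, Rmax; repeat destruct Rle_dec; lra. }
  eapply hom_trans; [exact h | apply hom_ext; [now apply hom_path_r in h|]].
  intros t [? ?]; unfold g, lmul; minmax; f_equal;
    first [ring | replace t with (1 / 2) by lra; field].
Qed.

(** For each obstacle one line serves for the whole arc, hence for its convex hull. This is stronger
    than avoiding the obstacles and makes the straight homotopy from the arc to its chord stay
    clear. *)
Definition piece_clear (obs : list (list zpt)) (a : R -> C) (u v : R) : Prop :=
  forall h, In h obs -> exists n, forall t, u <= t <= v ->
    forall w, In w h -> dot n (toC w) < dot n (a t).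

Lemma hom_restr_seg obs a u v : path (clear obs) a -> 0 <= u <= v -> v <= 1 ->
  piece_clear obs a u v -> hom (clear obs) (restr a u v) (seg (a u) (a v)).
Proof.
  intros Ha Hu Hv Hp.
  assert (Hi : forall t, I01 t -> u <= u + (v - u) * t <= v) by (unfold I01; intros; nra).
  assert (Hr : path (clear obs) (restr a u v)).
  { apply (path_reparam _ a (fun t => u + (v - u) * t)); trivial; try (intros t; cts; fail);
      intros t Ht; specialize (Hi t Ht); split; lra. }
  assert (Hs : forall t, I01 t -> D (seg (a u) (a v) t)).
  { intros t Ht; apply D_convex; trivial; apply Ha; split; lra. }
  assert (Hd : forall n c t, I01 t -> c < dot n (a u) -> c < dot n (a v) ->
    c < dot n (seg (a u) (a v) t)).
  { intros n c t Ht ? ?; unfold seg; rewrite dot_lin; now apply Rlt_convex2. }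
  apply hom_straight; trivial.
  - apply path_seg; intros t Ht; apply clear_of_sep; auto.
    intros h Hh; destruct (Hp h Hh) as [n Hn]; exists n; intros w Hw.
    apply Hd; trivial; apply Hn; trivial; lra.
  - rewrite seg_0; unfold restr; f_equal; ring.
  - rewrite seg_1; unfold restr; f_equal; ring.
  - intros s t Hs' Ht; apply clear_of_sep.
    + apply D_convex; auto; apply Hr; trivial.
    + intros h Hh; destruct (Hp h Hh) as [n Hn]; exists n; intros w Hw.
      assert (dot n (toC w) < dot n (seg (a u) (a v) t))
        by (apply Hd; trivial; apply Hn; trivial; lra).
      assert (dot n (toC w) < dot n (restr a u v t)) by (apply Hn; auto).
      rewrite dot_lin; now apply Rlt_convex2.
Qed.

Fixpoint pieces_clear (obs : list (list zpt)) (a : R -> C) (u : R) (l : list R) : Prop :=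
  match l with
  | [] => u <= 1
  | v :: l' => u <= v /\ piece_clear obs a u v /\ pieces_clear obs a v l'
  end.

Lemma pieces_clear_le obs a u l : pieces_clear obs a u l -> u <= endpt u l <= 1.
Proof.
  revert u; induction l as [|v l IH]; intros u; simpl; [lra|].
  intros (? & _ & H); specialize (IH v H); lra.
Qed.

Lemma hom_inscribed obs a u l : path (clear obs) a -> 0 <= u -> pieces_clear obs a u l ->
  hom (clear obs) (restr a u (endpt u l)) (pl (a u) (map a l)).
Proof.
  intros Ha; revert u; induction l as [|v l IH]; intros u Hu H; simpl in *.
  - apply hom_ext.
    + apply (path_reparam _ a (fun t => u + (u - u) * t)); trivial; try (intros t; cts; fail); intros t Ht; split; lra.
    + intros t _; unfold restr; f_equal; ring.
  - destruct H as (Huv & Hp & H); pose proof (pieces_clear_le _ _ _ _ H).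
    eapply hom_trans; [apply (hom_split _ a u v); trivial; lra|].
    apply hom_mul; [apply hom_restr_seg; trivial; lra | apply IH; trivial; lra|].
    unfold restr; f_equal; ring.
Qed.

Lemma hom_polygon obs a l : path (clear obs) a -> pieces_clear obs a 0 (l ++ [1]) ->
  hom (clear obs) a (pl (a 0) (map a (l ++ [1]))).
Proof.
  intros Ha H; eapply hom_trans; [|apply hom_inscribed; trivial; lra].
  apply hom_ext; trivial; intros t _; rewrite endpt_app; simpl; unfold restr; f_equal; ring.
Qed.

(** * Transport of loops along a realized motion *)

Lemma ball_CE (x y : C) (e : R) :
  ball x e y <-> Rabs (fst y - fst x) < e /\ Rabs (snd y - snd x) < e.
Proof. reflexivity. Qed.

Lemma D_coords y : D y -> -4 <= fst y <= 4 /\ -4 <= snd y <= 4.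
Proof.
  unfold D; intros H; pose proof (Rmax_Cmod y) as Ht.
  pose proof (Rmax_l (Rabs (fst y)) (Rabs (snd y))); pose proof (Rmax_r (Rabs (fst y)) (Rabs (snd y))).
  split; apply Rabs_le_between; lra.
Qed.

Lemma Cmod_Ci : Cmod Ci = 1.
Proof. unfold Cmod, Ci; simpl; replace (_ + _) with 1 by ring; apply sqrt_1. Qed.

Lemma Cmod_le_sum (y : C) : Cmod y <= Rabs (fst y) + Rabs (snd y).
Proof.
  replace y with (RtoC (fst y) + Ci * RtoC (snd y))%C at 1
    by (destruct y; unfold Ci, RtoC, Cplus, Cmult; simpl; f_equal; ring).
  eapply Rle_trans; [apply Cmod_triangle|]; rewrite Cmod_mult, !Cmod_R, Cmod_Ci; lra.
Qed.

Lemma D_closed y : ~ D y -> exists e, 0 < e /\ forall z, ball y e z -> ~ D z.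
Proof.
  unfold D; intros H; apply Rnot_le_lt in H.
  exists ((Cmod y - 4) / 2); split; [lra|]; intros z Hz HD; destruct (proj1 (ball_CE _ _ _) Hz) as [B1 B2].
  pose proof (Cmod_triangle z (y - z)) as Ht.
  assert (H2 : Cmod (y - z) <= Rabs (fst z - fst y) + Rabs (snd z - snd y)).
  { rewrite (Rabs_minus_sym (fst z)), (Rabs_minus_sym (snd z)); exact (Cmod_le_sum (y - z)). }
  replace (z + (y - z))%C with y in Ht by ring.
  lra.
Qed.

Lemma C_separated (y z : C) : y <> z -> exists e, 0 < e /\ ~ ball y e z.
Proof.
  intros H; apply NNPP; intros Hn; apply H.
  assert (Hb : forall e, 0 < e -> ball y e z).
  { intros e He; apply NNPP; intros Hb; apply Hn; eauto. }
  assert (HR : forall a b : R, (forall e, 0 < e -> Rabs (a - b) < e) -> b = a).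
  { intros a b HR; destruct (Req_dec a b) as [|Hab]; auto.
    specialize (HR (Rabs (a - b)) (Rabs_pos_lt _ (Rminus_eq_contra _ _ Hab))); lra. }
  destruct y as [y1 y2], z as [z1 z2]; f_equal; apply HR; intros e He;
    destruct (proj1 (ball_CE _ _ _) (Hb e He)); trivial.
Qed.

(** A continuous bijection between compact spaces is a homeomorphism; here it is
    [(t, y) |-> (t, h t y)]. *)
Lemma continuous_on_inverse (h g : R -> C -> C) :
  continuous_on (fun p : R * C => I01 (fst p) /\ D (snd p)) (fun p => h (fst p) (snd p)) ->
  (forall t y, I01 t -> D y -> D (g t y)) ->
  (forall t y, I01 t -> D y -> g t (h t y) = y) ->
  (forall t y, I01 t -> D y -> h t (g t y) = y) ->
  continuous_on (fun p : R * C => I01 (fst p) /\ D (snd p)) (fun p => g (fst p) (snd p)).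
Proof.
  intros Hc HgD Hgh Hhg [s0 y0] [Hs0 Hy0]; simpl in Hs0, Hy0 |- *.
  apply filterlim_locally; intros eps; set (x0 := g s0 y0).
  (* Every point (u, v) has a neighbourhood in which solutions x of [h s x = y], for (s, y) close to
     (s0, y0), lie within eps of x0: either the neighbourhood itself is that close, or it contains
     no solution, because [h s0] sends (u, v) away from y0 or because (u, v) lies outside [D].
     Compactness of a square containing [D] makes the radius uniform. *)
  assert (Hloc : forall u v : R, exists d : posreal, forall x s y,
    D x -> I01 s -> D y -> ball (u, v) d x -> ball s0 d s -> ball y0 d y ->
    h s x = y -> ball x0 eps x).
  { intros u v; set (x1 := (u, v) : C).
    destruct (excluded_middle_informative (ball x0 (eps / 2) x1)) as [H1|H1].
    { exists (pos_div_2 eps); intros x s y _ _ _ Hx _ _ _.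
      replace (pos eps) with (eps / 2 + eps / 2) by field.
      apply ball_triangle with x1; trivial. }
    destruct (excluded_middle_informative (D x1)) as [H2|H2].
    - assert (Hne : h s0 x1 <> y0).
      { intros E; apply H1; replace x1 with x0;
          [apply (ball_center x0 (pos_div_2 eps)) | unfold x0; rewrite <- E; now apply Hgh]. }
      destruct (C_separated _ _ Hne) as (e & He & Hsep).
      specialize (Hc (s0, x1) (conj Hs0 H2)); simpl in Hc.
      apply filterlim_locally with (eps := mkposreal (e / 2) ltac:(lra)) in Hc.
      destruct Hc as [d Hd].
      assert (Hm : 0 < Rmin d (e / 2)) by (apply Rmin_pos; [apply cond_pos | lra]).
      exists (mkposreal _ Hm); simpl; intros x s y Hx Hs Hy Bx Bs By E.
      exfalso; apply Hsep; replace e with (e / 2 + e / 2) by field.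
      apply ball_triangle with y.
      + rewrite <- E; apply (Hd (s, x)); [|split; trivial].
        split; simpl; eapply ball_le; eauto using Rmin_l.
      + apply ball_sym; eapply ball_le; eauto using Rmin_r.
    - destruct (D_closed _ H2) as (e & He & Hn); exists (mkposreal e He).
      intros x s y Hx _ _ Bx _ _ _; now destruct (Hn x Bx). }
  set (delta := fun u v =>
    proj1_sig (constructive_indefinite_description _ (Hloc u v))).
  destruct (compactness_value_2d (-4) 4 (-4) 4 delta) as [d Hd].
  exists d; intros [s y] [Bs By] [Hs Hy]; simpl in *.
  assert (HD : D (g s y)) by auto; destruct (D_coords _ HD) as [Hx1 Hx2].
  destruct (NNPP _ (Hd _ _ Hx1 Hx2)) as (u & v & _ & _ & B1 & B2 & Hle).
  unfold delta in B1, B2, Hle.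
  destruct (constructive_indefinite_description _ (Hloc u v)) as [d' Hd']; simpl in *.
  apply (Hd' (g s y) s y); auto.
  - now apply ball_CE.
  - eapply ball_le; eauto.
  - eapply ball_le; eauto.
Qed.

Definition off (m : nat -> R -> C) (t : R) (y : C) : Prop :=
  D y /\ forall i, idx i -> y <> m i t.

Lemma Cmod_u0 : Cmod u0 = 4.
Proof.
  unfold Cmod, u0; simpl; replace (_ + _) with (4 * 4) by ring; apply sqrt_square; lra.
Qed.

Lemma D_u0 : D u0.
Proof. unfold D; rewrite Cmod_u0; lra. Qed.

(** A realization provides an inverse at each time separately; once they are chosen for all times,
    compactness makes them jointly continuous in time and point. *)
Lemma realizes_inverse m h : realizes m h -> exists g : R -> C -> C,
  continuous_on (fun p : R * C => I01 (fst p) /\ D (snd p)) (fun p => g (fst p) (snd p)) /\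
  forall t y, I01 t -> D y ->
    D (h t y) /\ D (g t y) /\ g t (h t y) = y /\ h t (g t y) = y.
Proof.
  intros (Hc & Hd & _).
  assert (Hex : forall t, exists g : C -> C, I01 t -> forall y, D y ->
    D (h t y) /\ D (g y) /\ g (h t y) = y /\ h t (g y) = y).
  { intros t; destruct (excluded_middle_informative (I01 t)) as [Ht|Ht];
      [|now exists (fun y => y)].
    destruct (Hd t Ht) as [(_ & HD & g & _ & HgD & Hgh & Hhg) _]; exists g; auto. }
  set (g := fun t => proj1_sig (constructive_indefinite_description _ (Hex t))).
  assert (Hg : forall t y, I01 t -> D y ->
    D (h t y) /\ D (g t y) /\ g t (h t y) = y /\ h t (g t y) = y).
  { intros t y Ht; unfold g.
    destruct (constructive_indefinite_description _ (Hex t)) as [g' Hg']; simpl; auto. }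
  exists g; split; trivial; apply (continuous_on_inverse h); trivial; apply Hg.
Qed.

Lemma realizes_continuous m h t : realizes m h -> I01 t -> continuous_on D (h t).
Proof.
  intros (Hc & _) Ht y Hy P HP; specialize (Hc (t, y) (conj Ht Hy) P HP).
  destruct Hc as [d Hd]; exists d; intros z Bz Hz; apply (Hd (t, z)); [|now split].
  split; [apply ball_center | exact Bz].
Qed.

Lemma realizes_off m h t y : realizes m h -> I01 t ->
  (forall i, idx i -> D (m i 0)) -> D y -> (off m t (h t y) <-> off m 0 y).
Proof.
  intros Hr Ht Hm Hy; destruct (realizes_inverse _ _ Hr) as (g & _ & Hg).
  destruct Hr as (_ & _ & _ & Hi); unfold off.
  split; intros [H1 H2]; split; trivial; try now apply Hg.
  - intros i Hidx E; subst y; apply (H2 i Hidx); auto.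
  - intros i Hidx E; apply (H2 i Hidx); rewrite <- (Hi i t) in E by trivial.
    rewrite <- (proj1 (proj2 (proj2 (Hg t y Ht Hy)))), E; now apply Hg; auto.
Qed.

(** The homotopy is [s |-> h 1 (h s^-1 (G s))]. *)
Lemma transport m h (G : R -> R -> C) : realizes m h ->
  (forall i, idx i -> D (m i 0)) ->
  (forall p : R * R, continuous (fun p => G (fst p) (clamp (snd p))) p) ->
  (forall s t, I01 s -> I01 t -> off m s (G s t)) ->
  (forall s, I01 s -> G s 0 = u0 /\ G s 1 = u0) ->
  hom (off m 1) (fun t => h 1 (G 0 t)) (G 1).
Proof.
  intros Hr Hm HG Hoff He.
  destruct (realizes_inverse _ _ Hr) as (g & Hgc & Hg).
  pose proof (realizes_continuous _ _ 1 Hr I01_1) as Hh1.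
  (* The base point lies on the boundary circle, which every [h s] fixes pointwise; hence the
     homotopy keeps the end points. *)
  assert (Hu : forall s, I01 s -> g s u0 = u0).
  { intros s Hs; destruct Hr as (_ & Hd & _); destruct (Hd s Hs) as [_ Hb].
    rewrite <- (Hb u0 Cmod_u0) at 1; apply Hg; auto using D_u0. }
  assert (H0 : forall y, D y -> g 0 y = y).
  { intros y Hy; destruct Hr as (_ & _ & Hid & _).
    rewrite <- (Hid y Hy) at 1; now apply Hg. }
  exists (fun p => h 1 (g (clamp (fst p)) (G (clamp (fst p)) (clamp (snd p))))).
  split; [|split; [|split]]; simpl.
  - intros p; apply (continuous_on_comp D (h 1)
      (fun p => g (clamp (fst p)) (G (clamp (fst p)) (clamp (snd p))))); trivial.
    + apply (continuous_on_comp (fun p : R * C => I01 (fst p) /\ D (snd p))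
        (fun p => g (fst p) (snd p))
        (fun p => (clamp (fst p), G (clamp (fst p)) (clamp (snd p))))); trivial.
      * apply continuous_pair; [apply continuous_clamp; cts|].
        apply (continuous_comp (fun p => (clamp (fst p), snd p))
          (fun p => G (fst p) (clamp (snd p)))); [|apply HG].
        apply continuous_pair; [apply continuous_clamp|]; cts.
      * intros q; simpl; split; auto; now apply Hoff.
    + intros q; apply Hg; auto; now apply Hoff.
  - intros s t Hs Ht; rewrite !clamp_id by trivial.
    destruct (Hoff s t Hs Ht) as [HD _].
    apply (realizes_off m h); auto; [now apply Hg|].
    apply (realizes_off m h s); auto; [now apply Hg|].
    destruct (Hg s (G s t) Hs HD) as (_ & _ & _ & ->); auto.
  - intros t Ht; rewrite !clamp_id by auto; split.
    + rewrite H0; trivial; now apply Hoff.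
    + apply Hg; auto; now apply Hoff.
  - intros s Hs; rewrite !clamp_id by auto; destruct (He s Hs) as [-> ->].
    rewrite Hu by trivial; destruct (He 0 I01_0) as [-> ->]; auto.
Qed.

(** * The standard g-base as a system of polygons *)

Definition zu0 : zpt := (0, -80)%Z.

Lemma toC_zu0 : toC zu0 = u0.
Proof. unfold toC, u0; simpl; f_equal; lra. Qed.

Definition points (l : list zpt) : list (list zpt) := map (fun v => [v]) l.

Lemma clear_points l y : D y -> (forall v, In v l -> y <> toC v) -> clear (points l) y.
Proof.
  intros HD Hl; apply clear_of_sep; trivial; intros h Hh.
  (* Along this direction the two scalar products differ by the squared distance from [y] to the
     puncture. *)
  apply in_map_iff in Hh; destruct Hh as (v & <- & Hv); exists (y - toC v)%C.
  intros w [<-|[]]; specialize (Hl v Hv).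
  destruct y as [y1 y2], (toC v) as [v1 v2]; unfold dot; simpl.
  assert (y1 - v1 <> 0 \/ y2 - v2 <> 0).
  { destruct (Req_dec y1 v1) as [->|]; [|left; now apply Rminus_eq_contra].
    destruct (Req_dec y2 v2) as [->|]; [tauto | right; now apply Rminus_eq_contra]. }
  assert (0 < (y1 - v1) * (y1 - v1) + (y2 - v2) * (y2 - v2)); [|nra].
  pose proof (Rle_0_sqr (y1 - v1)); pose proof (Rle_0_sqr (y2 - v2)).
  destruct H as [H|H]; apply Rsqr_pos_lt in H; unfold Rsqr in *; lra.
Qed.

Lemma points_clear l y v : clear (points l) y -> In v l -> y <> toC v.
Proof.
  intros [_ H] Hv ->; apply (H [v]); [now apply (in_map (fun v => [v]))|].
  intros n c Hc; apply Hc; simpl; auto.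
Qed.

Ltac idx_cases i Hi :=
  unfold idx in Hi; destruct i as [|[|[|[|[|[|?]]]]]]; try lia.

Definition model_zpts : list zpt := [(-20, 0); (0, 0); (20, 0); (40, 0); (60, 0)]%Z.

Lemma model_pt_toC i : idx i ->
  exists v, In v model_zpts /\ model_pt i = toC v.
Proof.
  intros Hi; exists (20 * (Z.of_nat i - 2), 0)%Z; split.
  - idx_cases i Hi; simpl; tauto.
  - unfold model_pt, toC, RtoC; cbn [fst snd].
    rewrite mult_IZR, minus_IZR, <- INR_IZR_INZ; f_equal; lra.
Qed.

Lemma model_zpts_pt v : In v model_zpts -> exists i, idx i /\ toC v = model_pt i.
Proof.
  unfold idx; simpl; intros H; repeat destruct H as [<-|H]; 
    [exists 1%nat | exists 2%nat | exists 3%nat | exists 4%nat | exists 5%nat | easy];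
    (split; [lia|]; unfold toC, model_pt, RtoC; simpl; f_equal; lra).
Qed.

(** The hulls of the paths followed by the five points: the last two points
    describe a quarter circle, then a vertical and a horizontal segment. *)
Definition model_traces : list (list zpt) :=
  [[(-20, 0)]; [(0, 0)]; [(20, 0)];
   [(40, 0); (40, -10); (50, -10)]; [(50, -10); (50, -20)]; [(50, -20); (0, -20)];
   [(60, 0); (60, 10); (50, 10)]; [(50, 10); (50, 20)]; [(50, 20); (0, 20)]]%Z.

Lemma in_hull_pt v : in_hull [v] (toC v).
Proof. intros n c H; apply H; simpl; auto. Qed.

Lemma in_hull_seg u v y t : I01 t -> y = seg (toC u) (toC v) t -> in_hull [u; v] y.
Proof.
  intros Ht -> n c H; unfold seg; rewrite dot_lin.
  assert (Hu : dot n (toC u) < c) by (apply H; simpl; auto).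
  assert (Hv : dot n (toC v) < c) by (apply H; simpl; auto).
  pose proof (Rlt_convex2 (- c) (- dot n (toC u)) (- dot n (toC v)) t Ht); lra.
Qed.

Lemma in_hull_tri u v w y p q r : 0 <= p -> 0 <= q -> 0 <= r -> p + q + r = 1 ->
  y = (RtoC p * toC u + RtoC q * toC v + RtoC r * toC w)%C -> in_hull [u; v; w] y.
Proof.
  intros Hp Hq Hr E -> n c H.
  assert (Hu : dot n (toC u) < c) by (apply H; simpl; auto).
  assert (Hv : dot n (toC v) < c) by (apply H; simpl; auto).
  assert (Hw : dot n (toC w) < c) by (apply H; simpl; auto).
  replace (dot n _) with (p * dot n (toC u) + q * dot n (toC v) + r * dot n (toC w))
    by (unfold dot; simpl; ring).
  pose proof (Rlt_convex3 (- c) (- dot n (toC u)) (- dot n (toC v)) (- dot n (toC w)) p q r); lra.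
Qed.

Ltac C_eq := unfold seg, toC, RtoC, Ci, cis, Cminus, Cplus, Copp, Cmult; simpl; f_equal; lra.

(** The third inequality places a quarter of the unit circle beyond its chord. It controls all the
    arcs that occur: those of the model motion, the small circles and the twisted stem. *)
Lemma quarter_pos a : 0 <= a <= PI / 2 -> 0 <= cos a /\ 0 <= sin a /\ 1 <= cos a + sin a.
Proof.
  intros Ha; pose proof PI_RGT_0.
  assert (0 <= cos a) by (apply cos_ge_0; lra); assert (0 <= sin a) by (apply sin_ge_0; lra).
  pose proof (sin2_cos2 a) as H2; unfold Rsqr in H2; pose proof (COS_bound a); pose proof (SIN_bound a).
  repeat split; nra.
Qed.

Lemma model_motion_trace i t : idx i -> I01 t ->
  exists h, In h model_traces /\ in_hull h (model_motion i t).
Proof.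
  intros Hi [Ht0 Ht1].
  assert (Hq : t <= 1 / 3 -> 0 <= PI / 2 * (3 * t) <= PI / 2)
    by (pose proof PI_RGT_0; split; nra).
  idx_cases i Hi; unfold model_motion, model_pt, model_center, model_arm.
  - exists [(-20, 0)]%Z; split; [simpl; tauto|].
    replace (RtoC (INR 1 - 2)) with (toC (-20, 0)%Z) by C_eq; apply in_hull_pt.
  - exists [(0, 0)]%Z; split; [simpl; tauto|].
    replace (RtoC (INR 2 - 2)) with (toC (0, 0)%Z) by C_eq; apply in_hull_pt.
  - exists [(20, 0)]%Z; split; [simpl; tauto|].
    replace (RtoC (INR 3 - 2)) with (toC (20, 0)%Z) by C_eq; apply in_hull_pt.
  - destruct (Rle_dec t (2 / 3)), (Rle_dec t (1 / 3)); try lra.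
    + destruct (quarter_pos _ (Hq r0)) as (Hc & Hs & Hcs).
      pose proof (COS_bound (PI / 2 * (3 * t))); pose proof (SIN_bound (PI / 2 * (3 * t))).
      exists [(40, 0); (40, -10); (50, -10)]%Z; split; [simpl; tauto|].
      (* Barycentric coordinates of the arc in the triangle formed by its ends and the intersection
         of its end tangents. *)
      apply in_hull_tri with (1 - sin (PI / 2 * (3 * t)))
        (sin (PI / 2 * (3 * t)) + cos (PI / 2 * (3 * t)) - 1) (1 - cos (PI / 2 * (3 * t)));
        try lra; C_eq.
    + exists [(50, -10); (50, -20)]%Z; split; [simpl; tauto|].
      apply in_hull_seg with (3 * t - 1); [split; lra|]; C_eq.
    + exists [(50, -20); (0, -20)]%Z; split; [simpl; tauto|].
      apply in_hull_seg with (3 * t - 2); [split; lra|]; C_eq.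
  - destruct (Rle_dec t (2 / 3)), (Rle_dec t (1 / 3)); try lra.
    + destruct (quarter_pos _ (Hq r0)) as (Hc & Hs & Hcs).
      pose proof (COS_bound (PI / 2 * (3 * t))); pose proof (SIN_bound (PI / 2 * (3 * t))).
      exists [(60, 0); (60, 10); (50, 10)]%Z; split; [simpl; tauto|].
      apply in_hull_tri with (1 - sin (PI / 2 * (3 * t)))
        (sin (PI / 2 * (3 * t)) + cos (PI / 2 * (3 * t)) - 1) (1 - cos (PI / 2 * (3 * t)));
        try lra; C_eq.
    + exists [(50, 10); (50, 20)]%Z; split; [simpl; tauto|].
      apply in_hull_seg with (3 * t - 1); [split; lra|]; C_eq.
    + exists [(50, 20); (0, 20)]%Z; split; [simpl; tauto|].
      apply in_hull_seg with (3 * t - 2); [split; lra|]; C_eq.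
Qed.

Lemma clear_traces_off y t : clear model_traces y -> I01 t -> off model_motion t y.
Proof.
  intros [HD H] Ht; split; trivial; intros i Hi ->.
  destruct (model_motion_trace i t Hi Ht) as (h & Hh & Hhull); now apply (H h).
Qed.

Lemma model_motion_0 i : idx i -> model_motion i 0 = model_pt i.
Proof.
  intros Hi; idx_cases i Hi; trivial;
    unfold model_motion, model_center, model_arm, model_pt;
    (destruct (Rle_dec 0 (2 / 3)), (Rle_dec 0 (1 / 3)); try lra);
    rewrite !Rmult_0_r; unfold cis; rewrite cos_0, sin_0; C_eq.
Qed.

Lemma clear_model_off y : clear (points model_zpts) y -> off model_motion 0 y.
Proof.
  intros H; split; [apply H|]; intros i Hi; rewrite model_motion_0 by trivial.
  destruct (model_pt_toC i Hi) as (v & Hv & ->); now apply (points_clear model_zpts).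
Qed.

Lemma off_model_DK y : off model_motion 1 y -> DK y.
Proof.
  intros [HD H]; split; trivial; intros HK.
  assert (H1 : model_center 1 = 0 /\ model_arm 1 = Ci).
  { unfold model_center, model_arm.
    destruct (Rle_dec 1 (2 / 3)), (Rle_dec 1 (1 / 3)); try lra; split; C_eq. }
  destruct H1 as [Hc Ha].
  assert (Hi : forall i, idx i -> y = model_motion i 1 -> False) by (intros i Hi E; exact (H i Hi E)).
  unfold K in HK; simpl in HK; unfold idx in Hi; destruct HK as [<-|[<-|[<-|[<-|[<-|[]]]]]].
  - apply (Hi 2%nat); [lia|]; unfold model_motion, model_pt; C_eq.
  - apply (Hi 3%nat); [lia|]; unfold model_motion, model_pt; C_eq.
  - apply (Hi 1%nat); [lia|]; unfold model_motion, model_pt; C_eq.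
  - apply (Hi 5%nat); [lia|]; unfold model_motion; rewrite Hc, Ha; ring.
  - apply (Hi 4%nat); [lia|]; unfold model_motion; rewrite Hc, Ha; ring.
Qed.

(** * The model loops: circles and stems *)

Lemma Cmod_cis a : Cmod (cis a) = 1.
Proof.
  unfold Cmod, cis; simpl.
  replace (_ + _) with (Rsqr (sin a) + Rsqr (cos a)) by (unfold Rsqr; ring).
  rewrite sin2_cos2; apply sqrt_1.
Qed.

Lemma cis_add a b : cis (a + b) = (cis a * cis b)%C.
Proof.
  unfold cis, Cmult; simpl; rewrite cos_plus, sin_plus; f_equal; ring.
Qed.

Definition model_len (i : nat) : R := Cmod (u0 - model_pt i).

(** The upper bound makes [model_len i / 20] an admissible radius, at most 1/4. *)
Lemma model_len_bounds i : idx i -> 4 <= model_len i <= 5.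
Proof.
  intros Hi; unfold model_len, Cmod.
  assert (H : 4 * 4 <= fst (u0 - model_pt i)%C ^ 2 + snd (u0 - model_pt i)%C ^ 2 <= 5 * 5).
  { unfold model_pt, u0, RtoC; simpl.
    idx_cases i Hi; simpl; lra. }
  split; [rewrite <- (sqrt_square 4) by lra | rewrite <- (sqrt_square 5) by lra];
    apply sqrt_le_1_alt; apply H.
Qed.

Lemma model_dir_eq i e : idx i ->
  (RtoC e * model_dir i)%C = (RtoC (e / model_len i) * (u0 - model_pt i))%C.
Proof.
  intros Hi; pose proof (model_len_bounds i Hi).
  unfold model_dir; fold (model_len i); rewrite RtoC_div by lra; field.
  intros E; apply RtoC_inj in E; lra.
Qed.

Lemma model_dir_mod i : idx i -> Cmod (model_dir i) = 1.
Proof.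
  intros Hi; pose proof (model_len_bounds i Hi).
  unfold model_dir; fold (model_len i).
  rewrite Cmod_div by (intros E; apply RtoC_inj in E; lra).
  fold (model_len i); rewrite Cmod_R, Rabs_pos_eq by lra; field; lra.
Qed.

Lemma model_pt_dist i j : idx i -> idx j -> i <> j ->
  1 <= Cmod (model_pt i - model_pt j).
Proof.
  intros Hi Hj Hij; unfold model_pt; rewrite <- RtoC_minus, Cmod_R, !INR_IZR_INZ.
  replace (_ - _) with (IZR (Z.of_nat i - Z.of_nat j)) by (rewrite minus_IZR; ring).
  rewrite <- abs_IZR; apply IZR_le; lia.
Qed.

Lemma model_pt_Im i : snd (model_pt i) = 0.
Proof. reflexivity. Qed.

Lemma model_pt_mod i : idx i -> Cmod (model_pt i) <= 3.
Proof.
  intros Hi; unfold model_pt; rewrite Cmod_R; apply Rabs_le.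
  idx_cases i Hi; simpl; lra.
Qed.

Lemma clear_model y : D y -> (forall i, idx i -> y <> model_pt i) ->
  clear (points model_zpts) y.
Proof.
  intros HD H; apply clear_points; trivial; intros v Hv.
  destruct (model_zpts_pt v Hv) as (i & Hi & ->); auto.
Qed.

Definition model_circle (e : R) (i : nat) (a : R) : C :=
  (model_pt i + RtoC e * model_dir i * cis a)%C.

Lemma model_circle_clear e i a : idx i -> 0 < e < 1 / 2 ->
  clear (points model_zpts) (model_circle e i a).
Proof.
  intros Hi He.
  assert (Hm : Cmod (RtoC e * model_dir i * cis a) = e).
  { rewrite !Cmod_mult, Cmod_cis, model_dir_mod, Cmod_R, Rabs_pos_eq by (trivial; lra); ring. }
  unfold model_circle; apply clear_model.
  - unfold D; eapply Rle_trans; [apply Cmod_triangle|].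
    rewrite Hm; pose proof (model_pt_mod i Hi); lra.
  - intros j Hj E; destruct (Nat.eq_dec j i) as [->|Hij].
    + assert (E0 : (RtoC e * model_dir i * cis a)%C = 0).
      { replace (RtoC e * model_dir i * cis a)%C with
          (model_pt i + RtoC e * model_dir i * cis a - model_pt i)%C by ring.
        rewrite E; ring. }
      rewrite E0, Cmod_0 in Hm; lra.
    + pose proof (model_pt_dist j i Hj Hi Hij) as H; rewrite <- E in H.
      replace (_ - _)%C with (RtoC e * model_dir i * cis a)%C in H by ring; lra.
Qed.

(** All model points are real, so the open lower half-plane keeps a stem away from all of them at
    once. *)
Lemma model_stem_Im e i s : idx i -> 0 < e -> I01 s ->
  snd (u0 + RtoC s * (model_circle e i 0 - u0))%C < 0.
Proof.
  intros Hi He [Hs0 Hs1]; pose proof (model_len_bounds i Hi).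
  unfold model_circle; rewrite model_dir_eq by trivial.
  assert (Hk : 0 < e / model_len i) by (apply Rdiv_lt_0_compat; lra).
  set (k := e / model_len i) in *.
  unfold cis; rewrite cos_0, sin_0; replace (snd _) with (-4 * ((1 - s) + s * k))
    by (unfold u0, model_pt; simpl; ring).
  destruct (Rlt_dec s (1 / 2)); nra.
Qed.

Lemma model_stem_clear e i s : idx i -> 0 < e < 1 / 2 -> I01 s ->
  clear (points model_zpts) (u0 + RtoC s * (model_circle e i 0 - u0))%C.
Proof.
  intros Hi He Hs; apply clear_model.
  - apply D_convex; trivial; [apply D_u0 | now apply model_circle_clear].
  - intros j Hj E; assert (He0 : 0 < e) by lra.
    pose proof (model_stem_Im e i s Hi He0 Hs) as H.
    rewrite E, model_pt_Im in H; lra.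
Qed.

Lemma model_loop_cases e i t : model_loop e i t =
  if Rle_dec t (1 / 3) then (u0 + RtoC (3 * t) * (model_circle e i 0 - u0))%C
  else if Rle_dec t (2 / 3) then model_circle e i (2 * PI * (3 * t - 1))
  else (u0 + RtoC (3 - 3 * t) * (model_circle e i 0 - u0))%C.
Proof.
  replace (model_circle e i 0) with (model_pt i + RtoC e * model_dir i)%C; [reflexivity|].
  unfold model_circle, cis; rewrite cos_0, sin_0; change (1, 0) with (RtoC 1); ring.
Qed.

Lemma model_circle_2PI e i : model_circle e i (2 * PI) = model_circle e i 0.
Proof. unfold model_circle, cis; now rewrite cos_2PI, sin_2PI, cos_0, sin_0. Qed.

Lemma path_model_loop e i : idx i -> 0 < e < 1 / 2 ->
  path (clear (points model_zpts)) (model_loop e i).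
Proof.
  intros Hi He; split.
  (* The three legs are added as displacements, each clamped to its own third of the time, which
     makes continuity evident. *)
  - apply continuous_on_ext_in with (fun t =>
      u0 + RtoC (clamp (3 * t)) * (model_circle e i 0 - u0)
      + (model_circle e i (2 * PI * clamp (3 * t - 1)) - model_circle e i 0)
      + RtoC (clamp (3 * t - 2)) * (u0 - model_circle e i 0))%C.
    + intros t [? ?]; rewrite model_loop_cases.
      match goal with |- ?a = ?b => change (@eq C a b) end.
      destruct (Rle_dec t (1 / 3)); [|destruct (Rle_dec t (2 / 3))].
      * rewrite (clamp_id (3 * t)), !clamp_0 by (try split; lra); rewrite Rmult_0_r; ring.
      * rewrite (clamp_id (3 * t - 1)), (clamp_0 (3 * t - 2)), (clamp_1 (3 * t)) by (try split; lra); ring.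
      * rewrite (clamp_id (3 * t - 2)), !clamp_1 by (try split; lra).
        rewrite Rmult_1_r, model_circle_2PI, !RtoC_minus; ring_simplify.
        replace (RtoC 2) with (RtoC 3 - 1)%C by (rewrite <- RtoC_minus; f_equal; lra); ring.
    + apply continuous_on_of; intros t; unfold model_circle; cts;
        apply continuous_clamp; cts.
  - intros t [? ?]; rewrite model_loop_cases.
    destruct Rle_dec; [apply model_stem_clear; trivial; split; lra|].
    destruct Rle_dec; [now apply model_circle_clear | apply model_stem_clear; trivial; split; lra].
Qed.

Lemma model_loop_ends e i : model_loop e i 0 = u0 /\ model_loop e i 1 = u0.
Proof.
  rewrite !model_loop_cases.
  destruct (Rle_dec 0 _), (Rle_dec 1 (1 / 3)), (Rle_dec 1 (2 / 3)); try lra.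
  split; [rewrite Rmult_0_r | replace (3 - 3 * 1) with 0 by ring]; ring.
Qed.

(** A model loop depends affinely on its radius, so the straight homotopy runs through the model
    loops of intermediate radii. *)
Lemma model_loop_eps e e' i : idx i -> 0 < e < 1 / 2 -> 0 < e' < 1 / 2 ->
  hom (clear (points model_zpts)) (model_loop e i) (model_loop e' i).
Proof.
  intros Hi He He'; destruct (model_loop_ends e i), (model_loop_ends e' i).
  apply hom_straight; try now apply path_model_loop; try congruence.
  1,2: congruence.
  intros s t Hs Ht.
  replace (_ + _)%C with (model_loop (e + s * (e' - e)) i t).
  - pose proof (Rlt_convex2 0 e e' s Hs ltac:(lra) ltac:(lra)).
    pose proof (Rlt_convex2 (- (1 / 2)) (- e) (- e') s Hs ltac:(lra) ltac:(lra)).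
    apply path_model_loop; trivial; lra.
  - rewrite !model_loop_cases; unfold model_circle.
    rewrite (RtoC_plus e), (RtoC_mult s), (RtoC_minus e').
    repeat destruct Rle_dec; ring.
Qed.

(** The loop around the model point [20 k] becomes a square when the radius of
    its circle is a twentieth of the distance to [u0]. *)
Definition square (k : Z) : list zpt :=
  [(20 * k - k, -4); (20 * k + 4, - k); (20 * k + k, 4); (20 * k - 4, k); (20 * k - k, -4)]%Z.

Lemma model_circle_toC i a : idx i ->
  model_circle (model_len i / 20) i a =
  (RtoC (INR i - 2) + (- (INR i - 2) / 20, - 4 / 20)%R * cis a)%C.
Proof.
  intros Hi; pose proof (model_len_bounds i Hi).
  unfold model_circle; rewrite model_dir_eq by trivial.
  replace (model_len i / 20 / model_len i) with (1 / 20) by (field; lra).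
  unfold model_pt; f_equal; f_equal; unfold u0, RtoC, Cminus, Cplus, Copp, Cmult; simpl.
  f_equal; field.
Qed.

Lemma Cmod_sqr y : Cmod y * Cmod y = fst y * fst y + snd y * snd y.
Proof. unfold Cmod; simpl; rewrite sqrt_sqrt; nra. Qed.

Lemma dot_plus n y z : dot n (y + z)%C = dot n y + dot n z.
Proof. unfold dot; simpl; ring. Qed.

(** The centre of the circle is separated from a quarter arc along the bisector of the arc, which is
    the direction of [w] times (1 + i) [cis al]. Any other puncture is at distance at least 1, more
    than the radius, and the direction joining the two centres works. *)
Lemma model_circle_piece e i al v : idx i -> 0 < e < 1 / 2 -> In v model_zpts ->
  exists n, forall a, al <= a <= al + PI / 2 -> dot n (toC v) < dot n (model_circle e i a).
Proof.
  intros Hi He Hv; destruct (model_zpts_pt v Hv) as (j & Hj & ->); unfold model_circle.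
  set (w := (RtoC e * model_dir i)%C).
  assert (Hw : Cmod w = e)
    by (unfold w; rewrite Cmod_mult, model_dir_mod, Cmod_R, Rabs_pos_eq by (trivial; lra); ring).
  destruct (Nat.eq_dec j i) as [->|Hij].
  - exists (w * (cos al - sin al, sin al + cos al)%R)%C; intros a Ha.
    pose proof (Cmod_sqr w) as Hw2; rewrite Hw in Hw2.
    replace a with (al + (a - al)) by ring; set (d := a - al).
    assert (Hd : 0 <= d <= PI / 2) by (unfold d; lra).
    destruct (quarter_pos d Hd) as (_ & _ & Hcs).
    rewrite dot_plus.
    replace (dot _ (w * _)%C) with
      ((fst w * fst w + snd w * snd w) * (Rsqr (sin al) + Rsqr (cos al)) * (cos d + sin d))
      by (unfold cis, dot, Rsqr; simpl; rewrite cos_plus, sin_plus; ring).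
    rewrite sin2_cos2, <- Hw2; assert (0 < e * e) by nra; nra.
  - exists (model_pt i - model_pt j)%C; intros a _.
    pose proof (model_pt_dist i j Hi Hj (not_eq_sym Hij)) as H.
    pose proof (Cmod_sqr (model_pt i - model_pt j)) as H2.
    assert (Hr : Rabs (fst (w * cis a)%C) <= e).
    { apply Rle_trans with (Cmod (w * cis a)).
      - eapply Rle_trans; [apply Rmax_l | apply Rmax_Cmod].
      - rewrite Cmod_mult, Cmod_cis; lra. }
    apply Rabs_le_between in Hr; rewrite dot_plus.
    set (r := fst (w * cis a)%C) in *; set (r' := snd (w * cis a)%C).
    set (di := INR i); set (dj := INR j).
    assert (1 <= (di - dj) * (di - dj)).
    { replace ((di - dj) * (di - dj)) with (Cmod (model_pt i - model_pt j)
        * Cmod (model_pt i - model_pt j)) by (rewrite H2; unfold di, dj, model_pt; simpl; ring).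
      nra. }
    unfold dot; fold r r'; unfold model_pt; simpl; fold di dj.
    assert (di - dj <= -1 \/ 1 <= di - dj) as [|] by
      (destruct (Rle_dec (di - dj) (-1)), (Rle_dec 1 (di - dj)); auto; nra); nra.
Qed.

Lemma model_loop_circle e i t : 1 / 3 <= t <= 2 / 3 ->
  model_loop e i t = model_circle e i (2 * PI * (3 * t - 1)).
Proof.
  intros Ht; rewrite model_loop_cases.
  destruct (Rle_dec t (1 / 3)), (Rle_dec t (2 / 3)); try lra; trivial.
  replace t with (1 / 3) by lra; replace (3 * (1 / 3)) with 1 by field.
  rewrite Rminus_diag, Rmult_0_r; ring.
Qed.

Lemma model_loop_stem e i t : idx i -> 0 < e -> I01 t -> t <= 1 / 3 \/ 2 / 3 <= t ->
  snd (model_loop e i t) < 0.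
Proof.
  intros Hi He [Ht0 Ht1] H; rewrite model_loop_cases.
  destruct (Rle_dec t (1 / 3)); [|destruct (Rle_dec t (2 / 3))].
  - apply model_stem_Im; trivial; split; lra.
  - replace (2 * PI * (3 * t - 1)) with (2 * PI) by (replace t with (2 / 3) by lra; field).
    rewrite model_circle_2PI.
    replace (model_circle e i 0) with (u0 + RtoC 1 * (model_circle e i 0 - u0))%C by ring.
    apply model_stem_Im; trivial.
  - apply model_stem_Im; trivial; split; lra.
Qed.

Lemma model_loop_pieces e i : idx i -> 0 < e < 1 / 2 ->
  pieces_clear (points model_zpts) (model_loop e i) 0 [1 / 3; 5 / 12; 1 / 2; 7 / 12; 2 / 3; 1].
Proof.
  intros Hi He.
  assert (Hstem : forall u v, 0 <= u -> v <= 1 -> v <= 1 / 3 \/ 2 / 3 <= u ->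
    piece_clear (points model_zpts) (model_loop e i) u v).
  { intros u v Hu Hv Huv h Hh; exists (0, -1); intros t Ht w Hw.
    apply in_map_iff in Hh; destruct Hh as (p & <- & Hp); destruct Hw as [<-|[]].
    destruct (model_zpts_pt p Hp) as (j & _ & ->).
    assert (He0 : 0 < e) by lra; assert (Hti : I01 t) by (split; lra).
    pose proof (model_loop_stem e i t Hi He0 Hti ltac:(lra)).
    unfold dot, model_pt; simpl; lra. }
  assert (Hcirc : forall u v, 1 / 3 <= u -> v <= 2 / 3 -> v - u = 1 / 12 ->
    piece_clear (points model_zpts) (model_loop e i) u v).
  { intros u v Hu Hv Huv h Hh.
    apply in_map_iff in Hh; destruct Hh as (p & <- & Hp).
    destruct (model_circle_piece e i (2 * PI * (3 * u - 1)) p Hi He Hp) as [n Hn].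
    exists n; intros t Ht w [<-|[]]; rewrite model_loop_circle by lra; apply Hn.
    pose proof PI_RGT_0; split; nra. }
  simpl; repeat split; try lra; first [apply Hstem; lra | apply Hcirc; lra].
Qed.

Lemma model_loop_square i : idx i ->
  map (model_loop (model_len i / 20) i) [1 / 3; 5 / 12; 1 / 2; 7 / 12; 2 / 3; 1] =
  map toC (square (Z.of_nat i - 2) ++ [zu0]).
Proof.
  intros Hi; destruct (model_loop_ends (model_len i / 20) i) as [_ E1].
  cbn [map]; rewrite E1, !model_loop_circle by lra; rewrite !model_circle_toC by trivial.
  replace (2 * PI * (3 * (1 / 3) - 1)) with 0 by field.
  replace (2 * PI * (3 * (5 / 12) - 1)) with (PI / 2) by field.
  replace (2 * PI * (3 * (1 / 2) - 1)) with PI by field.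
  replace (2 * PI * (3 * (7 / 12) - 1)) with (3 * (PI / 2)) by field.
  replace (2 * PI * (3 * (2 / 3) - 1)) with (2 * PI) by field.
  unfold cis; rewrite cos_0, sin_0, cos_PI2, sin_PI2, cos_PI, sin_PI, cos_3PI2, sin_3PI2,
    cos_2PI, sin_2PI.
  unfold square; cbn [map app]; unfold toC at 1 2 3 4 5; cbn [fst snd].
  repeat first [rewrite plus_IZR | rewrite minus_IZR | rewrite mult_IZR | rewrite opp_IZR];
    rewrite <- INR_IZR_INZ; rewrite toC_zu0.
  unfold RtoC, Cplus, Cmult; simpl.
  repeat match goal with
         | |- _ :: _ = _ :: _ => apply f_equal2
         | |- (_, _) = (_, _) => apply f_equal2
         end; try reflexivity; field.
Qed.

(** These polygons do not meet [model_traces]. *)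
Definition zvertices (i : nat) : list zpt :=
  (match i with
   | 1%nat => [(-12, 0); (-20, 10); (-28, 0)]
   | 2%nat => [(-6, -20); (6, -6); (6, 6); (-6, 6); (-8, -20)]
   | 3%nat => [(-4, -22); (0, -15); (20, -8); (28, 0); (20, 8); (12, 0); (0, -10); (-6, -20)]
   | 4%nat => [(56, -24); (56, -8); (50, -5); (42, 4); (36, 4); (36, -16); (-4, -16); (-4, -24)]
   | 5%nat => [(64, -26); (66, 0); (56, 28); (-4, 28); (-4, 16); (46, 16); (46, 6); (54, -2);
               (58, -24)]
   | _ => []
   end)%Z.

(** The point -7i/2, on the boundary of the disk that [rho] turns rigidly. The polygons leave [u0]
    and return to it through this point, so only the segment between the two is bent. *)
Definition zstem : zpt := (0, -70)%Z.

Definition zgen (i : nat) : list zpt := [zstem] ++ zvertices i ++ [zstem].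

(** The radius is changed to the value at which the inscribed polygon has integer vertices; the
    contraction onto [zgen i] is then evaluated, with the initial model points as the only
    obstacles. *)
Lemma model_loop_zgen e i : idx i -> 0 < e < 1 / 2 ->
  hom (clear (points model_zpts)) (model_loop e i) (zloop zu0 (zgen i)).
Proof.
  intros Hi He; pose proof (model_len_bounds i Hi).
  apply hom_trans with (model_loop (model_len i / 20) i); [apply model_loop_eps; trivial; lra|].
  apply hom_trans with (zloop zu0 (square (Z.of_nat i - 2))).
  - pose proof (hom_polygon (points model_zpts) (model_loop (model_len i / 20) i)
      [1 / 3; 5 / 12; 1 / 2; 7 / 12; 2 / 3]) as Hp; cbn [app] in Hp.
    rewrite model_loop_square in Hp by trivial.
    destruct (model_loop_ends (model_len i / 20) i) as [E0 _].
    rewrite E0, <- toC_zu0 in Hp.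
    apply Hp; [apply path_model_loop | apply model_loop_pieces]; trivial; lra.
  - apply zhom_spec; idx_cases i Hi;
      vm_compute; reflexivity.
Qed.

Lemma zgen_traces i : idx i -> zedges model_traces zu0 (zgen i ++ [zu0]) = true.
Proof.
  intros Hi; idx_cases i Hi; vm_compute; reflexivity.
Qed.

Lemma D_model_motion i : idx i -> D (model_motion i 0).
Proof.
  intros Hi; rewrite model_motion_0 by trivial; unfold D.
  pose proof (model_pt_mod i Hi); lra.
Qed.

Lemma zloop_0 p l : zloop p l 0 = toC p.
Proof. unfold zloop, zpl; now rewrite pl_0. Qed.

Lemma zloop_1 p l : zloop p l 1 = toC p.
Proof. unfold zloop, zpl; rewrite pl_1, map_app, endpt_app; reflexivity. Qed.

Lemma gbase_zgen x i : standard_gbase x -> idx i -> hom DK (x i) (zloop zu0 (zgen i)).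
Proof.
  intros (e & g & He & (h & Hr & Hg) & Hx) Hi.
  pose proof (model_loop_zgen e i Hi He) as H1.
  pose proof (zedges_spec _ _ _ (zgen_traces i Hi)) as H2.
  apply path_pl in H2; change (pl _ _) with (zloop zu0 (zgen i)) in H2.
  assert (H3 : hom (off model_motion 1) (fun t => h 1 (model_loop e i t))
                 (fun t => h 1 (zloop zu0 (zgen i) t))).
  { apply hom_map with (clear (points model_zpts)); trivial.
    - apply continuous_on_subset with D; [now intros y [] | now apply (realizes_continuous model_motion)].
    - intros y Hy; apply (realizes_off model_motion h 1 y); auto using D_model_motion.
      + apply Hy.
      + now apply clear_model_off. }
  (* Transport of a constant family: the polygon avoids the moving points at all times. *)
  assert (H4 : hom (off model_motion 1) (fun t => h 1 (zloop zu0 (zgen i) t)) (zloop zu0 (zgen i))).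
  { apply (transport model_motion h (fun _ => zloop zu0 (zgen i))); auto using D_model_motion.
    - intros p; apply continuous_extension_comp; [apply H2 | cts].
    - intros s t Hs Ht; apply clear_traces_off; trivial; now apply H2.
    - intros s _; now rewrite zloop_0, zloop_1, toC_zu0. }
  apply (hom_mono _ _ _ _ off_model_DK).
  eapply hom_trans; [|exact H4].
  eapply hom_trans; [|exact H3].
  apply hom_sym, hom_ext; [now apply hom_path_l in H3|].
  intros t Ht; rewrite Hx, Hg; trivial; now apply path_model_loop.
Qed.

(** * The rotation of the fiber *)

Lemma Cmult_eq_0 y z : (y * z = 0)%C -> y = 0 \/ z = 0.
Proof.
  intros H; destruct (excluded_middle_informative (y = 0)) as [|Hy]; [auto|].
  destruct (excluded_middle_informative (z = 0)) as [|Hz]; [auto|].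
  now destruct (Cmult_neq_0 _ _ Hy Hz).
Qed.

Lemma K_equation y : K y <-> (y * (y * y + 1) * (y * y - 1))%C = 0.
Proof.
  assert (Ci2 : (Ci * Ci)%C = (- (1))%C) by C_eq.
  assert (Cm1 : RtoC (-1) = (- (1))%C) by C_eq.
  unfold K; simpl; split.
  - intros [<-|[<-|[<-|[<-|[<-|[]]]]]];
      rewrite ?Cm1; try ring.
    + rewrite Ci2; ring.
    + replace (- Ci * - Ci)%C with (- (1))%C by (rewrite <- Ci2; ring); ring.
  - replace (y * y + 1)%C with ((y - Ci) * (y + Ci))%C
      by (replace (RtoC 1) with (- (Ci * Ci))%C by (rewrite Ci2; ring); ring).
    replace (y * y - 1)%C with ((y - 1) * (y - RtoC (-1)))%C by (rewrite Cm1; ring).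
    assert (Hd : forall a b : C, (a - b)%C = 0 -> b = a)
      by (intros a b H; replace b with (a - (a - b))%C by ring; rewrite H; ring).
    intros H; apply Cmult_eq_0 in H; destruct H as [H|H];
      [apply Cmult_eq_0 in H; destruct H as [H|H]|].
    + auto.
    + apply Cmult_eq_0 in H; destruct H as [H|H]; [apply Hd in H; tauto|].
      do 4 right; left; replace y with (y + Ci - Ci)%C by ring; rewrite H; ring.
    + apply Cmult_eq_0 in H; destruct H as [H|H]; apply Hd in H; tauto.
Qed.

Lemma cis_neg a : (cis a * cis (- a))%C = 1.
Proof. rewrite <- cis_add, Rplus_opp_r; unfold cis; now rewrite cos_0, sin_0. Qed.

(** For z = wc with c = [cis (PI * s)], the left side is c^5 w (w^2 + 1)(w^2 - 1). Hence the fibre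
    over [cis (2 * PI * s)] is [K] turned by the angle [PI * s]. *)
Lemma fiber_equation s z :
  (z * (z * z + cis (2 * PI * s)) * (z * z - cis (2 * PI * s)))%C = 0 <->
  K (z * cis (- (PI * s)))%C.
Proof.
  rewrite K_equation; set (w := (z * cis (- (PI * s)))%C); set (c := cis (PI * s)).
  assert (Hz : z = (w * c)%C).
  { unfold w, c; replace (_ * _)%C with (z * (cis (PI * s) * cis (- (PI * s))))%C by ring.
    rewrite cis_neg; ring. }
  replace (cis (2 * PI * s)) with (c * c)%C
    by (unfold c; rewrite <- cis_add; f_equal; ring).
  assert (Hc : c <> 0).
  { intros E; pose proof (Cmod_cis (PI * s)) as H; fold c in H; rewrite E, Cmod_0 in H; lra. }
  replace (_ * _)%C with (c * c * c * c * c * (w * (w * w + 1) * (w * w - 1)))%C at 1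
    by (rewrite Hz; ring).
  split; intros H; [|rewrite H; ring].
  repeat (apply Cmult_eq_0 in H; destruct H as [H|H]; [repeat (apply Cmult_eq_0 in H;
    destruct H as [H|H]; [|now destruct (Hc H)]); now destruct (Hc H) |]); trivial.
Qed.

Lemma K_mod y : K y -> Cmod y <= 1.
Proof.
  unfold K; simpl; intros [<-|[<-|[<-|[<-|[<-|[]]]]]];
    rewrite ?Cmod_opp, ?Cmod_Ci, ?Cmod_R; try lra; unfold Rabs; destruct Rcase_abs; lra.
Qed.

(** Rotates the disk of radius 7/2, which contains the polygons [zgen i] up to
    their stems, and is the identity on the boundary of [D]. *)
Definition rho (s : R) (y : C) : C := (y * cis (PI * s * clamp (8 - 2 * Cmod y)))%C.

Lemma rho_mod s y : Cmod (rho s y) = Cmod y.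
Proof. unfold rho; rewrite Cmod_mult, Cmod_cis; ring. Qed.

Lemma rho_inner s y : Cmod y <= 7 / 2 -> rho s y = (y * cis (PI * s))%C.
Proof. intros H; unfold rho; rewrite clamp_1 by lra; now rewrite Rmult_1_r. Qed.

Lemma rho_0 y : rho 0 y = y.
Proof. unfold rho, cis; rewrite Rmult_0_r, Rmult_0_l, cos_0, sin_0; change (1, 0) with (RtoC 1); ring. Qed.

Lemma rho_u0 s : rho s u0 = u0.
Proof.
  unfold rho; rewrite Cmod_u0, clamp_0 by lra.
  unfold cis; rewrite Rmult_0_r, cos_0, sin_0; change (1, 0) with (RtoC 1); ring.
Qed.

Lemma rho_1_inner y : Cmod y <= 7 / 2 -> rho 1 y = (- y)%C.
Proof.
  intros H; rewrite rho_inner, Rmult_1_r by trivial; unfold cis; rewrite cos_PI, sin_PI.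
  C_eq || C_eq.
Qed.

(** The fibre at time s lies in the unit disk, where [rho s] is the rotation that carries [K] onto
    it. *)
Lemma rho_off m s y : fiber_motion m -> I01 s -> DK y -> off m s (rho s y).
Proof.
  intros [_ Hm] Hs [HD HK]; split; [unfold D; now rewrite rho_mod|].
  intros i Hi E; apply HK.
  destruct (proj2 (Hm s Hs (rho s y)) (ex_intro _ i (conj Hi (eq_sym E)))) as (_ & _ & H).
  apply fiber_equation in H; pose proof (K_mod _ H) as H1.
  rewrite Cmod_mult, Cmod_cis, rho_mod in H1.
  rewrite rho_inner in H by lra.
  replace (y * _ * _)%C with (y * (cis (PI * s) * cis (- (PI * s))))%C in H by ring.
  rewrite cis_neg in H; now rewrite Cmult_1_r in H.
Qed.

Lemma off_fiber_DK m y : fiber_motion m -> off m 1 y -> DK y.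
Proof.
  intros [_ Hm] [HD H]; split; trivial; intros HK.
  destruct (proj1 (Hm 1 I01_1 y)) as (i & Hi & E); [|now apply (H i)].
  split; [unfold E; rewrite Cmod_cis; lra|]; split; trivial.
  replace (cis (2 * PI * 1)) with (RtoC 1); [now apply K_equation|].
  rewrite Rmult_1_r; unfold cis; now rewrite cos_2PI, sin_2PI.
Qed.

Lemma DK_off_fiber m y : fiber_motion m -> DK y -> off m 0 y.
Proof.
  intros Hm Hy; rewrite <- (rho_0 y); now apply rho_off.
Qed.

(** The loops [rho s (a t)] avoid the fibre at time s and keep the base point, so [transport]
    applies: every realization acts on classes of loops as the explicit map [rho 1]. *)
Lemma fiber_motion_action m f a : fiber_motion m -> induces m f -> path DK a ->
  a 0 = u0 -> a 1 = u0 -> hom DK (fun t => f (a t)) (fun t => rho 1 (a t)).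
Proof.
  intros Hm (h & Hr & Hf) Ha e0 e1.
  assert (HD : forall i, idx i -> D (m i 0)).
  { intros i Hi; destruct Hm as [(_ & H & _) _]; auto. }
  apply hom_trans with (fun t => h 1 (a t)).
  - apply hom_sym, hom_ext.
    + apply path_map with (U := DK); trivial.
      * apply continuous_on_subset with D; [now intros y [] | now apply (realizes_continuous m)].
      * intros y Hy; apply (off_fiber_DK m); trivial.
        apply (realizes_off m h 1 y); auto; [apply Hy | now apply DK_off_fiber].
    + intros t Ht; symmetry; apply Hf, Ha, Ht.
  - apply hom_mono with (off m 1); [intros y; now apply off_fiber_DK|].
    pose proof (transport m h (fun s t => rho s (a t)) Hr HD) as T; simpl in T.
    eapply hom_trans; [|apply T].
    + apply hom_ext; [|intros; now rewrite rho_0].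
      apply path_map with (U := DK); trivial.
      * apply continuous_on_subset with D; [now intros y [] | now apply (realizes_continuous m)].
      * intros y Hy; apply (realizes_off m h 1 y); auto; [apply Hy | now apply DK_off_fiber].
    + intros p; unfold rho; cts; try (apply continuous_clamp; cts);
        apply continuous_extension_comp; try apply Ha; cts.
    + intros s t Hs Ht; apply rho_off; trivial; now apply Ha.
    + intros s _; now rewrite e0, e1, rho_u0.
Qed.

(** * Images of the polygons under the half turn *)

Definition K_zpts : list zpt := [(0, 0); (20, 0); (-20, 0); (0, 20); (0, -20)]%Z.

Lemma clear_DK y : clear (points K_zpts) y -> DK y.
Proof.
  intros H; split; [apply H|]; intros HK.
  assert (Hv : forall v, In v K_zpts -> y = toC v -> False)
    by (intros v Hv E; now apply (points_clear K_zpts y v)).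
  unfold K in HK; simpl in HK, Hv; destruct HK as [<-|[<-|[<-|[<-|[<-|[]]]]]].
  - apply (Hv (0, 0)%Z); [tauto | C_eq].
  - apply (Hv (20, 0)%Z); [tauto | C_eq].
  - apply (Hv (-20, 0)%Z); [tauto | C_eq].
  - apply (Hv (0, 20)%Z); [tauto | C_eq].
  - apply (Hv (0, -20)%Z); [tauto | C_eq].
Qed.

Definition zopp (v : zpt) : zpt := (- fst v, - snd v)%Z.

Lemma toC_zopp v : toC (zopp v) = (- toC v)%C.
Proof.
  unfold toC, zopp, Copp; cbn [fst snd]; rewrite !opp_IZR; f_equal; field.
Qed.

Lemma pl_opp p l t : pl (- p)%C (map Copp l) t = (- pl p l t)%C.
Proof.
  revert p t; induction l as [|q l IH]; intros p t; simpl; trivial.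
  unfold lmul; destruct Rle_dec; [unfold seg; ring | apply IH].
Qed.

Lemma pl_mod r p l : Cmod p <= r -> (forall q, In q l -> Cmod q <= r) ->
  forall t, I01 t -> Cmod (pl p l t) <= r.
Proof.
  revert p; induction l as [|q l IH]; intros p Hp Hl; simpl; trivial.
  intros t Ht; apply (lmul_in (fun y => Cmod y <= r)); trivial.
  - intros s Hs; apply Cmod_convex; auto; now apply Hl; left.
  - apply IH; [now apply Hl; left | intros; now apply Hl; right].
Qed.

Lemma rho_1_zpl p l : (forall v, In v (p :: l) -> Cmod (toC v) <= 7 / 2) ->
  forall t, I01 t -> rho 1 (zpl p l t) = zpl (zopp p) (map zopp l) t.
Proof.
  intros H t Ht; rewrite rho_1_inner.
  - unfold zpl; rewrite <- pl_opp, toC_zopp, !map_map; f_equal.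
    apply map_ext; intros v; symmetry; apply toC_zopp.
  - apply pl_mod; trivial; [apply H; now left|].
    intros q Hq; apply in_map_iff in Hq; destruct Hq as (v & <- & Hv); apply H; now right.
Qed.

(** The image is a spiral running counterclockwise from -4i to 7i/2 through 15/4. Its two quarter
    turns lie in the half-planes x - y >= 7/2 and x + y >= 7/2, while both forms are at most 1 on
    [K]; the polygon is inscribed at the parameters 0, 1/2 and 1. *)
Lemma rho_stem :
  hom (clear (points K_zpts)) (fun t => rho 1 (seg (toC zu0) (toC zstem) t))
    (zpl zu0 [(75, 0); (0, 70)]%Z).
Proof.
  set (a := fun t => rho 1 (seg (toC zu0) (toC zstem) t)).
  assert (Hm : forall t, I01 t -> Cmod (seg (toC zu0) (toC zstem) t) = 4 - t / 2).
  { intros t [? ?]; replace (seg _ _ t) with (- RtoC (4 - t / 2) * Ci)%C by C_eq.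
    rewrite Cmod_mult, Cmod_opp, Cmod_Ci, Cmod_R, Rabs_pos_eq by lra; ring. }
  assert (Ha : forall t, I01 t -> a t = (RtoC (4 - t / 2) * cis (PI * t - PI / 2))%C).
  { intros t Ht; unfold a, rho; rewrite Hm by trivial.
    rewrite Rmult_1_r, clamp_id by (destruct Ht; split; lra).
    replace (8 - 2 * (4 - t / 2)) with t by field.
    unfold cis; rewrite cos_minus, sin_minus, cos_PI2, sin_PI2; C_eq. }
  assert (H1 : forall t, 0 <= t <= 1 / 2 -> 7 / 2 <= dot (1, -1) (a t)).
  { intros t Ht; rewrite Ha by (split; lra).
    destruct (quarter_pos (PI / 2 - PI * t)) as (_ & _ & H); [pose proof PI_RGT_0; nra|].
    rewrite cos_minus, sin_minus, cos_PI2, sin_PI2 in H.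
    unfold dot, cis; simpl; rewrite cos_minus, sin_minus, cos_PI2, sin_PI2; nra. }
  assert (H2 : forall t, 1 / 2 <= t <= 1 -> 7 / 2 <= dot (1, 1) (a t)).
  { intros t Ht; rewrite Ha by (split; lra).
    destruct (quarter_pos (PI * t - PI / 2)) as (_ & _ & H); [pose proof PI_RGT_0; nra|].
    unfold dot, cis; simpl; nra. }
  assert (HK : forall n v, n = (1, -1) \/ n = (1, 1) -> In v K_zpts -> dot n (toC v) <= 1).
  { intros n v Hn Hv; unfold K_zpts in Hv; simpl in Hv.
    destruct Hn as [-> | ->]; repeat destruct Hv as [<-|Hv]; try easy;
      unfold dot, toC; simpl; lra. }
  assert (Hp : pieces_clear (points K_zpts) a 0 [1 / 2; 1]).
  { cbn [pieces_clear]; repeat split; try lra; intros h Hh; apply in_map_iff in Hh;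
      destruct Hh as (v & <- & Hv); [exists (1, -1) | exists (1, 1)];
      intros t Ht w [<-|[]].
    - pose proof (HK (1, -1) v ltac:(auto) Hv); specialize (H1 t Ht); lra.
    - pose proof (HK (1, 1) v ltac:(auto) Hv); specialize (H2 t Ht); lra. }
  assert (HP : path (clear (points K_zpts)) a).
  { split.
    - apply continuous_on_of; intros t; unfold a, rho, seg; cts; apply continuous_clamp; cts.
    - intros t Ht; apply clear_of_sep.
      + unfold D, a; rewrite rho_mod, Hm by trivial; destruct Ht; lra.
      + intros h Hh; destruct Hp as (_ & Hp1 & _ & Hp2 & _), Ht.
        destruct (Rle_dec t (1 / 2)) as [Hle|Hle]; [destruct (Hp1 h Hh) as [n Hn] | destruct (Hp2 h Hh) as [n Hn]];
          exists n; intros v Hv; apply Hn; trivial; lra. }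
  pose proof (hom_polygon (points K_zpts) a [1 / 2] HP Hp) as H; cbn [app map] in H.
  rewrite !Ha in H by (unfold I01; lra); unfold zpl; cbn [map].
  replace (PI * 0 - PI / 2) with (- (PI / 2)) in H by field.
  replace (PI * (1 / 2) - PI / 2) with 0 in H by field.
  replace (PI * 1 - PI / 2) with (PI / 2) in H by field.
  unfold cis in H; rewrite cos_neg, sin_neg, cos_0, sin_0, cos_PI2, sin_PI2 in H.
  replace (toC zu0) with (RtoC (4 - 0 / 2) * (0%R, (- (1))%R))%C by C_eq.
  replace (toC (75, 0)%Z) with (RtoC (4 - 1 / 2 / 2) * (1, 0)%R)%C by C_eq.
  replace (toC (0, 70)%Z) with (RtoC (4 - 1 / 2) * (0, 1)%R)%C by C_eq.
  exact H.
Qed.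

(** The stem is replaced by the polygon inscribed in its spiral image, the rest by the opposite
    vertices; (0, 70) is opposite to [zstem]. *)
Definition zimg (i : nat) : list zpt :=
  ([(75, 0); (0, 70)] ++ map zopp (zvertices i) ++ [(0, 70); (75, 0)])%Z.

Lemma zpl_app obs p l l' : zedges obs p (l ++ l') = true ->
  hom (clear obs) (zpl p (l ++ l')) (lmul (zpl p l) (zpl (endpt p l) l')).
Proof.
  intros H; apply zedges_spec in H; unfold zpl; rewrite map_app in *.
  replace (toC (endpt p l)) with (endpt (toC p) (map toC l)); [now apply pl_app|].
  clear H; revert p; induction l; simpl; auto.
Qed.

Lemma zgen_clear i : zedges (points K_zpts) zu0 (zgen i ++ [zu0]) = true.
Proof. destruct i as [|[|[|[|[|[|i]]]]]]; vm_compute; reflexivity. Qed.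

Lemma zimg_clear i : idx i -> zedges (points K_zpts) zu0 (zimg i ++ [zu0]) = true.
Proof.
  intros Hi; idx_cases i Hi; vm_compute; reflexivity.
Qed.

Lemma zvertices_mod i v : idx i -> In v (zstem :: zvertices i ++ [zstem]) ->
  Cmod (toC v) <= 7 / 2.
Proof.
  intros Hi Hv.
  assert (H : forallb (fun v => fst v * fst v + snd v * snd v <=? 4900)%Z
                (zstem :: zvertices i ++ [zstem]) = true).
  { idx_cases i Hi; reflexivity. }
  rewrite forallb_forall in H; specialize (H v Hv); apply Z.leb_le, IZR_le in H.
  rewrite plus_IZR, !mult_IZR in H; unfold Cmod, toC; cbn [fst snd].
  rewrite <- (sqrt_square (7 / 2)) by lra; apply sqrt_le_1_alt; simpl; lra.
Qed.

Lemma zedges_sub obs p l l' : zedges obs p (l ++ l') = true -> zedges obs (endpt p l) l' = true.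
Proof.
  revert p; induction l as [|q l IH]; intros p; simpl; trivial.
  rewrite Bool.andb_true_iff; intros [_ H]; auto.
Qed.

Lemma rho_DK y : DK y -> DK (rho 1 y).
Proof.
  intros [HD HK]; split; [unfold D; now rewrite rho_mod|]; intros H; apply HK.
  pose proof (K_mod _ H) as Hm; rewrite rho_mod in Hm.
  rewrite rho_1_inner in H by lra; apply K_equation in H; apply K_equation.
  replace (y * (y * y + 1) * (y * y - 1))%C with
    (- (- y * (- y * - y + 1) * (- y * - y - 1)))%C by ring.
  rewrite H; ring.
Qed.

Lemma continuous_rho s y : continuous (rho s) y.
Proof. unfold rho; cts; apply continuous_clamp; cts. Qed.

(** The loop is cut at [zstem] into a stem, a closed polygon in the disk of radius 7/2 and the
    reversed stem. The middle is turned by [rho_1_zpl], the ends by [rho_stem] and its inverse. *)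
Lemma rho_zgen i : idx i ->
  hom DK (fun t => rho 1 (zloop zu0 (zgen i) t)) (zloop zu0 (zimg i)).
Proof.
  intros Hi; set (v := zvertices i).
  set (c := zpl zstem (v ++ [zstem])); set (stem := seg (toC zu0) (toC zstem)).
  set (stem' := seg (toC zstem) (toC zu0)).
  assert (Eg : zgen i ++ [zu0] = zstem :: (v ++ [zstem]) ++ [zu0])
    by reflexivity.
  assert (Hev : forall p, endpt p (v ++ [zstem]) = zstem) by (intros; now rewrite endpt_app).
  pose proof (zgen_clear i) as Hg; rewrite Eg in Hg.
  assert (Hg' : zedges (points K_zpts) zstem ((v ++ [zstem]) ++ [zu0]) = true)
    by (cbn [zedges] in Hg; apply Bool.andb_true_iff in Hg; apply Hg).
  pose proof (zedges_spec _ _ _ Hg) as Eg1; destruct Eg1 as [Es _].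
  pose proof (zedges_spec _ _ _ (zedges_sub _ _ _ _ Hg')) as Eg2.
  rewrite Hev in Eg2; destruct Eg2 as [Es' _].
  assert (Pc : path (clear (points K_zpts)) c).
  { pose proof (zedges_spec _ _ _ Hg') as H; rewrite map_app in H.
    apply edges_app in H; apply path_pl, H. }
  assert (Ec : c 0 = toC zstem /\ c 1 = toC zstem).
  { unfold c, zpl; rewrite pl_0, pl_1, map_app, endpt_app; auto. }
  assert (H1 : hom (clear (points K_zpts)) (zloop zu0 (zgen i)) (lmul stem (lmul c stem'))).
  { unfold zloop; rewrite Eg; unfold zpl; cbn [map pl].
    apply hom_mul; [now apply hom_refl, path_seg | |unfold stem; now rewrite seg_1, pl_0].
    eapply hom_trans; [apply zpl_app, Hg'|]; rewrite Hev.
    apply hom_mul; [now apply hom_refl | | ].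
    - apply hom_unit_r; [now apply path_seg | intros; unfold stem'; now rewrite seg_1].
    - unfold zpl; rewrite pl_0; apply Ec. }
  apply hom_mono with (V := DK) in H1; [|apply clear_DK].
  apply hom_map with (V := DK) (F := rho 1) in H1;
    [|apply continuous_on_of, continuous_rho | apply rho_DK].
  eapply hom_trans; [exact H1|].
  apply hom_mono with (clear (points K_zpts)); [apply clear_DK|].
  pose proof (zimg_clear i Hi) as Him.
  assert (Ei : zimg i ++ [zu0] =
    [(75, 0); (0, 70)]%Z ++ map zopp (v ++ [zstem]) ++ [(75, 0)%Z; zu0]).
  { unfold zimg; fold v; rewrite map_app, <- !app_assoc; reflexivity. }
  rewrite Ei in Him; pose proof (zedges_sub _ _ _ _ Him) as Him'.
  pose proof (zedges_sub _ _ _ _ Him') as Him2.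
  assert (Hev' : forall p, endpt p (map zopp (v ++ [zstem])) = (0, 70)%Z)
    by (intros; now rewrite map_app, endpt_app).
  assert (Hc : hom (clear (points K_zpts)) (fun t => rho 1 (c t))
                 (zpl (0, 70)%Z (map zopp (v ++ [zstem])))).
  { apply hom_sym, hom_ext.
    - apply zedges_spec in Him'; rewrite map_app in Him'; apply edges_app in Him'.
      apply path_pl, Him'.
    - intros t Ht; symmetry; apply rho_1_zpl; trivial; intros w Hw; now apply (zvertices_mod i). }
  assert (Hs' : hom (clear (points K_zpts)) (fun t => rho 1 (stem' t))
                  (zpl (0, 70)%Z [(75, 0)%Z; zu0])).
  { apply hom_trans with (linv (fun t => rho 1 (stem t))).
    - apply hom_sym, hom_ext; [apply path_inv, (hom_path_l _ _ _ rho_stem)|].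
      intros t _; unfold linv, stem, stem', seg; f_equal; rewrite RtoC_minus; ring.
    - eapply hom_trans; [apply hom_inv, rho_stem|].
      apply (pl_rev _ _ [toC (75, 0)%Z]).
      apply zedges_spec in Him; rewrite map_app in Him; apply edges_app in Him; apply Him. }
  assert (Hr : hom (clear (points K_zpts)) (lmul (fun t => rho 1 (stem t))
    (lmul (fun t => rho 1 (c t)) (fun t => rho 1 (stem' t)))) (zloop zu0 (zimg i))).
  2:{ eapply hom_trans; [apply hom_sym, hom_ext | exact Hr]; [now apply hom_path_l in Hr|].
      intros t _; unfold lmul; now repeat destruct Rle_dec. }
  apply hom_trans with (lmul (zpl zu0 [(75, 0); (0, 70)]%Z)
    (lmul (zpl (0, 70)%Z (map zopp (v ++ [zstem]))) (zpl (0, 70)%Z [(75, 0)%Z; zu0]))).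
  - apply hom_mul; [apply rho_stem | apply hom_mul; trivial |].
    + unfold stem'; now rewrite (proj2 Ec), seg_0.
    + unfold stem; now rewrite lmul_0, (proj1 Ec), seg_1.
  - unfold zloop; rewrite Ei; apply hom_sym.
    eapply hom_trans; [apply zpl_app, Him|].
    apply hom_mul; [now apply hom_refl, (hom_path_r _ _ _ rho_stem) | |].
    + eapply hom_trans; [apply zpl_app, Him'|]; rewrite Hev'; apply hom_refl.
      apply path_mul; [now apply (hom_path_r _ _ _ Hc) | now apply (hom_path_r _ _ _ Hs') |].
      unfold zpl; rewrite pl_0, pl_1, map_map.
      rewrite map_app, endpt_app; reflexivity.
    + unfold zpl; now rewrite pl_0, pl_1.
Qed.

(** * Words in loops *)

Lemma is_loop_path a : is_loop a <-> path DK a /\ a 0 = u0 /\ a 1 = u0.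
Proof. unfold is_loop, path; tauto. Qed.

Lemma homotopic_hom a b : homotopic a b -> hom DK a b.
Proof.
  intros (H & Hc & HU & Hab & He).
  exists (fun p => H (clamp (fst p), clamp (snd p))); split; [|split; [|split]]; simpl.
  - intros p; apply (continuous_on_comp (fun p => I01 (fst p) /\ I01 (snd p)) H
      (fun p => (clamp (fst p), clamp (snd p)))); simpl; auto.
    apply continuous_pair; apply continuous_clamp; cts.
  - intros s t Hs Ht; auto.
  - intros t Ht; rewrite !clamp_id by auto; auto.
  - intros s Hs; rewrite !clamp_id by auto; destruct (He s Hs) as [-> ->].
    destruct (Hab 0 I01_0) as [<- _], (Hab 1 I01_1) as [<- _], (He 0 I01_0) as [-> ->]; auto.
Qed.

Lemma hom_homotopic a b : hom DK a b -> a 0 = u0 -> a 1 = u0 -> homotopic a b.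
Proof.
  intros (H & Hc & HU & Hab & He) e0 e1; exists H.
  split; [now apply continuous_on_of|]; split; [trivial|]; split; [trivial|].
  intros s Hs; destruct (He s Hs); split; congruence.
Qed.

(** Words are lists of integers: k stands for the k-th loop, -k for its inverse, and 0 for the
    trivial loop. *)
Definition letter (x : nat -> R -> C) (a : Z) : R -> C :=
  match a with
  | Z0 => lone
  | Zpos p => x (Pos.to_nat p)
  | Zneg p => linv (x (Pos.to_nat p))
  end.

Fixpoint ev (x : nat -> R -> C) (w : list Z) : R -> C :=
  match w with [] => lone | a :: w' => lmul (letter x a) (ev x w') end.

Definition winv (w : list Z) : list Z := map Z.opp (rev w).

Definition cancel (a : Z) (w : list Z) : list Z :=
  match w with
  | b :: w' => if (a + b =? 0)%Z then w' else a :: w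
  | [] => [a]
  end.

Definition reduce (w : list Z) : list Z := fold_right cancel [] w.

Definition loops (x : nat -> R -> C) : Prop := forall i, is_loop (x i).

Lemma is_loop_lone : is_loop lone.
Proof.
  apply is_loop_path; split; [split|split; reflexivity].
  { apply continuous_on_of; intros t; apply continuous_const. }
  intros t _; split; [apply D_u0|]; intros H; apply K_mod in H.
  change (lone t) with u0 in H; rewrite Cmod_u0 in H; lra.
Qed.

Lemma is_loop_lmul a b : is_loop a -> is_loop b -> is_loop (lmul a b).
Proof.
  rewrite !is_loop_path; intros (Pa & a0 & a1) (Pb & b0 & b1).
  rewrite lmul_0, lmul_1; split; [|split]; trivial; apply path_mul; trivial; congruence.
Qed.

Lemma is_loop_linv a : is_loop a -> is_loop (linv a).
Proof.
  rewrite !is_loop_path; intros (Pa & a0 & a1); split; [now apply path_inv|].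
  unfold linv; rewrite Rminus_0_r; replace (1 - 1) with 0 by ring; auto.
Qed.

Lemma is_loop_letter x a : loops x -> is_loop (letter x a).
Proof.
  intros Hx; destruct a; simpl; [apply is_loop_lone | apply Hx | apply is_loop_linv, Hx].
Qed.

Lemma is_loop_ev x w : loops x -> is_loop (ev x w).
Proof.
  intros Hx; induction w; simpl; [apply is_loop_lone|].
  apply is_loop_lmul; trivial; now apply is_loop_letter.
Qed.

Lemma is_loop_hom a b : is_loop a -> hom DK a b -> is_loop b.
Proof.
  rewrite !is_loop_path; intros (Pa & a0 & a1) h; destruct (hom_ends _ _ _ h).
  split; [now apply hom_path_r in h|]; split; congruence.
Qed.

Lemma lhom_refl a : is_loop a -> hom DK a a.
Proof. intros H; apply is_loop_path in H; now apply hom_refl. Qed.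

Lemma lhom_mul a a' b b' : is_loop a -> is_loop b -> hom DK a a' -> hom DK b b' ->
  hom DK (lmul a b) (lmul a' b').
Proof.
  rewrite !is_loop_path; intros Ha Hb h h'; apply hom_mul; trivial.
  destruct Ha as (_ & _ & ->), Hb as (_ & -> & _); trivial.
Qed.

Lemma lhom_assoc a b c : is_loop a -> is_loop b -> is_loop c ->
  hom DK (lmul (lmul a b) c) (lmul a (lmul b c)).
Proof.
  rewrite !is_loop_path; intros (Pa & a0 & a1) (Pb & b0 & b1) (Pc & c0 & c1).
  apply hom_assoc; trivial; congruence.
Qed.

Lemma lhom_lone_l a : is_loop a -> hom DK (lmul lone a) a.
Proof.
  rewrite is_loop_path; intros (Pa & a0 & a1); apply hom_unit_l; trivial; now intros t.
Qed.

Lemma lhom_lone_r a : is_loop a -> hom DK (lmul a lone) a.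
Proof.
  rewrite is_loop_path; intros (Pa & a0 & a1); apply hom_unit_r; trivial; now intros t.
Qed.

Lemma lhom_linv_r a : is_loop a -> hom DK (lmul a (linv a)) lone.
Proof.
  rewrite is_loop_path; intros (Pa & a0 & a1); apply hom_inv_r; trivial; now intros t.
Qed.

Lemma lhom_linv_mul a b : is_loop a -> is_loop b ->
  hom DK (linv (lmul a b)) (lmul (linv b) (linv a)).
Proof.
  rewrite !is_loop_path; intros (Pa & a0 & a1) (Pb & b0 & b1).
  apply hom_linv_mul; trivial; congruence.
Qed.

#[local] Hint Resolve is_loop_lone is_loop_lmul is_loop_linv is_loop_letter is_loop_ev
  lhom_refl lhom_mul : loop.

Lemma ev_app x u v : loops x -> hom DK (ev x (u ++ v)) (lmul (ev x u) (ev x v)).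
Proof.
  intros Hx; induction u as [|a u IH]; simpl.
  - apply hom_sym, lhom_lone_l; auto with loop.
  - eapply hom_trans; [apply lhom_mul; [| | |exact IH]|apply hom_sym, lhom_assoc]; auto with loop.
Qed.

Lemma letter_opp x a : loops x -> hom DK (linv (letter x a)) (letter x (- a)).
Proof.
  intros Hx; assert (H : is_loop (linv (letter x a))) by auto with loop.
  apply is_loop_path in H; apply hom_ext; [apply H|].
  intros t _; destruct a; simpl; trivial; apply linv_linv.
Qed.

Lemma ev_winv x w : loops x -> hom DK (linv (ev x w)) (ev x (winv w)).
Proof.
  intros Hx; induction w as [|a w IH]; unfold winv; simpl.
  - apply lhom_refl; auto with loop.
  - rewrite map_app; fold (winv w); simpl.
    eapply hom_trans; [apply lhom_linv_mul; auto with loop|].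
    eapply hom_trans; [|apply hom_sym, ev_app; trivial].
    apply lhom_mul; auto with loop; simpl.
    eapply hom_trans; [apply letter_opp, Hx|].
    apply hom_sym, lhom_lone_r; auto with loop.
Qed.

Lemma ev_cancel x a w : loops x -> hom DK (ev x (a :: w)) (ev x (cancel a w)).
Proof.
  intros Hx; destruct w as [|b w]; [apply lhom_refl; auto with loop|].
  unfold cancel; destruct (Z.eqb_spec (a + b) 0) as [E|]; [|apply lhom_refl; auto with loop].
  replace b with (- a)%Z by lia; simpl.
  eapply hom_trans; [apply hom_sym, lhom_assoc; auto with loop|].
  eapply hom_trans; [|apply lhom_lone_l; auto with loop].
  apply lhom_mul; auto with loop.
  apply hom_trans with (lmul (letter x a) (linv (letter x a))); [|apply lhom_linv_r; auto with loop].
  apply lhom_mul; auto with loop; now apply hom_sym, letter_opp.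
Qed.

Lemma ev_reduce x w : loops x -> hom DK (ev x w) (ev x (reduce w)).
Proof.
  intros Hx; induction w as [|a w IH]; simpl; [apply lhom_refl; auto with loop|].
  eapply hom_trans; [|now apply ev_cancel]; simpl; apply lhom_mul; auto with loop.
Qed.

Lemma ev_eq x u v : loops x -> reduce u = reduce v -> hom DK (ev x u) (ev x v).
Proof.
  intros Hx E; eapply hom_trans; [now apply ev_reduce|].
  rewrite E; now apply hom_sym, ev_reduce.
Qed.

Lemma ev_congr x y w : loops x -> (forall i, hom DK (x i) (y i)) -> hom DK (ev x w) (ev y w).
Proof.
  intros Hx H; induction w as [|a w IH]; simpl; [apply lhom_refl; auto with loop|].
  apply lhom_mul; auto with loop.
  destruct a; simpl; [apply lhom_refl; auto with loop | apply H | apply hom_inv, H].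
Qed.

Lemma ev_solve x a w w' : loops x -> is_loop a ->
  hom DK (lmul a (ev x w)) (ev x w') -> hom DK a (ev x (w' ++ winv w)).
Proof.
  intros Hx Ha h.
  eapply hom_trans; [|apply hom_sym, ev_app, Hx].
  eapply hom_trans; [|apply lhom_mul; [| |exact h|apply ev_winv, Hx]; auto with loop].
  eapply hom_trans; [|apply hom_sym, lhom_assoc; auto with loop].
  eapply hom_trans; [apply hom_sym, lhom_lone_r, Ha|].
  apply lhom_mul; auto with loop; apply hom_sym, lhom_linv_r; auto with loop.
Qed.

(** * Normal closures *)

Lemma nc_hom rels a b : hom DK a b -> is_loop a -> normal_closure rels a ->
  normal_closure rels b.
Proof.
  intros h Ha; apply nc_homotopic; apply is_loop_path in Ha; now apply hom_homotopic.
Qed.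

Lemma nc_incl rels rels' :
  (forall l r, In (l, r) rels -> normal_closure rels' (lmul l (linv r))) ->
  forall a, normal_closure rels a -> normal_closure rels' a.
Proof.
  intros H a Ha; induction Ha; eauto using normal_closure.
Qed.

(** A certificate: the product of the conjugates u r u^-1, where r is the k-th relator, counted from
    0, or its inverse if the flag is [false]; an index out of range gives the empty word. For a
    relator l r^-1 each factor is one rewriting step: after the prefix u, [true] replaces l by r and
    [false] replaces r by l, up to free reduction. The steps end at the empty word. *)
Definition consequence (rs : list (list Z)) (c : list (list Z * nat * bool)) : list Z :=
  flat_map (fun '(u, k, b) =>
    let r := nth k rs [] in u ++ (if b : bool then r else winv r) ++ winv u) c.

Lemma nc_consequence rels x rs c w : loops x ->
  (forall r, In r rs -> normal_closure rels (ev x r)) ->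
  reduce (consequence rs c) = reduce w -> normal_closure rels (ev x w).
Proof.
  intros Hx Hrs E.
  apply nc_hom with (ev x (consequence rs c)); [now apply ev_eq | auto with loop |].
  clear E w; induction c as [|[[u k] b] c IH]; [apply nc_one|]; simpl.
  set (r := nth k rs []).
  assert (Hr : normal_closure rels (ev x r)).
  { unfold r; destruct (nth_in_or_default k rs []) as [Hin | ->]; [now apply Hrs | apply nc_one]. }
  assert (Hb : normal_closure rels (ev x (if b then r else winv r))).
  { destruct b; trivial.
    apply nc_hom with (linv (ev x r)); [now apply ev_winv | auto with loop | now apply nc_inv]. }
  set (s := if b then r else winv r) in *.
  apply nc_hom with (lmul (lmul (lmul (ev x u) (ev x s)) (linv (ev x u))) (ev x (consequence rs c)));
    [| auto with loop |].
  - eapply hom_trans; [|apply hom_sym, ev_app, Hx].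
    apply lhom_mul; auto with loop.
    eapply hom_trans; [apply lhom_assoc; auto with loop|].
    eapply hom_trans; [|apply hom_sym, ev_app, Hx].
    apply lhom_mul; auto with loop.
    eapply hom_trans; [|apply hom_sym, ev_app, Hx].
    apply lhom_mul; auto with loop; now apply ev_winv.
  - apply nc_mul; trivial; apply nc_conj; auto with loop.
Qed.

(** * The braid monodromy of the generators *)

Definition gen (i : nat) : R -> C := zloop zu0 (zgen i).

(** Meant for words with positive letters; then it is a single polygon representing the product of
    the generators. *)
Definition zjoin (w : list Z) : list zpt :=
  flat_map (fun a => zgen (Z.to_nat a) ++ [zu0]) w.

(** The image [b] of the [i]-th generator under the half turn is determined by
    the equation [b * pre_word i = post_word i]. *)
Definition pre_word (i : nat) : list Z :=
  (match i with
   | 1%nat => [4] | 2%nat => [4; 3] | 3%nat => [4; 3; 2; 1] | 5%nat => [5; 4; 3; 2; 1] | _ => []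
   end)%Z.

Definition post_word (i : nat) : list Z :=
  (match i with
   | 1%nat => [4; 3] | 2%nat => [4; 3; 2] | 3%nat => [4; 3; 2; 1; 1] | 4%nat => [5]
   | 5%nat => [5; 4; 3; 2; 1; 4] | _ => []
   end)%Z.

Definition braid_word (i : nat) : list Z := post_word i ++ winv (pre_word i).

Lemma zloop_is_loop l : zedges (points K_zpts) zu0 (l ++ [zu0]) = true -> is_loop (zloop zu0 l).
Proof.
  intros H; apply is_loop_path; rewrite zloop_0, zloop_1, toC_zu0; split; auto.
  apply zedges_spec, path_pl in H; destruct H as [H1 H2].
  split; trivial; intros t Ht; apply clear_DK, H2, Ht.
Qed.

Lemma gen_loops : loops gen.
Proof. intros i; apply zloop_is_loop, zgen_clear. Qed.

Lemma zedges_app obs p l l' : zedges obs p l = true -> zedges obs (endpt p l) l' = true ->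
  zedges obs p (l ++ l') = true.
Proof.
  revert p; induction l as [|q l IH]; intros p; simpl; trivial.
  rewrite !Bool.andb_true_iff; intros [H1 H2] H3; auto.
Qed.

Lemma zjoin_clear w : zedges (points K_zpts) zu0 (zjoin w ++ [zu0]) = true.
Proof.
  induction w as [|a w IH]; [vm_compute; reflexivity|].
  change (zjoin (a :: w)) with ((zgen (Z.to_nat a) ++ [zu0]) ++ zjoin w); rewrite <- app_assoc.
  apply zedges_app; [apply zgen_clear | now rewrite endpt_app].
Qed.

Lemma ev_zjoin w : forallb (Z.ltb 0) w = true -> hom DK (ev gen w) (zloop zu0 (zjoin w)).
Proof.
  induction w as [|a w IH]; simpl forallb.
  - intros _; apply hom_ext; [apply is_loop_path, is_loop_lone|].
    intros t _; unfold zloop, zpl; cbn [app map pl zjoin flat_map]; rewrite toC_zu0.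
    change (ev gen [] t) with u0; unfold lmul, seg; destruct Rle_dec; [ring | trivial].
  - rewrite Bool.andb_true_iff; intros [Ha Hw]; simpl ev.
    apply hom_trans with (lmul (gen (Z.to_nat a)) (zloop zu0 (zjoin w))).
    + pose proof gen_loops as Hg; apply lhom_mul; auto with loop.
      destruct a; try discriminate; apply lhom_refl; auto with loop.
    + apply hom_mono with (clear (points K_zpts)); [apply clear_DK|].
      change (zjoin (a :: w)) with ((zgen (Z.to_nat a) ++ [zu0]) ++ zjoin w); rewrite <- app_assoc.
      apply zloop_app; [apply zgen_clear | apply zjoin_clear].
Qed.

(** Both words are positive, so each side is one closed polygon and a single evaluation of [zhom]
    compares them. *)
Lemma image_relation i : idx i ->
  hom DK (lmul (zloop zu0 (zimg i)) (ev gen (pre_word i))) (ev gen (post_word i)).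
Proof.
  intros Hi; pose proof (zimg_clear i Hi) as Him.
  eapply hom_trans with (lmul (zloop zu0 (zimg i)) (zloop zu0 (zjoin (pre_word i)))).
  { apply lhom_mul; auto using zloop_is_loop, gen_loops, is_loop_ev.
    - apply lhom_refl; now apply zloop_is_loop.
    - apply ev_zjoin; idx_cases i Hi; reflexivity. }
  eapply hom_trans with (zloop zu0 (zjoin (post_word i))).
  2:{ apply hom_sym, ev_zjoin; idx_cases i Hi;
        reflexivity. }
  apply hom_mono with (clear (points K_zpts)); [apply clear_DK|].
  eapply hom_trans; [apply zloop_app; [exact Him | apply zjoin_clear]|].
  apply hom_sym, zhom_spec; clear Him.
  destruct i as [|[|[|[|[|[|i]]]]]]; try lia; vm_compute; reflexivity.
Qed.

Lemma gbase_loop x i : standard_gbase x -> idx i -> is_loop (x i).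
Proof.
  intros Hx Hi; apply is_loop_hom with (gen i); [apply gen_loops|].
  now apply hom_sym, gbase_zgen.
Qed.

(** [beta] acts as the induced map, and this acts as [rho 1]; [rho 1] being explicit, [x i] may be
    replaced by its polygon before the turn. *)
Lemma braid_action beta x i : local_braid_monodromy beta -> standard_gbase x -> idx i ->
  hom DK (fun t => beta (x i t)) (ev gen (braid_word i)).
Proof.
  intros (_ & m & f & Hm & Hf & Ha) Hx Hi.
  pose proof (gbase_loop x i Hx Hi) as Hl.
  eapply hom_trans; [apply homotopic_hom, (Ha _ Hl)|].
  apply is_loop_path in Hl; destruct Hl as (Pl & l0 & l1).
  eapply hom_trans; [now apply (fiber_motion_action m)|].
  eapply hom_trans.
  { apply hom_map with (U := DK) (F := rho 1);
      [apply continuous_on_of, continuous_rho | apply rho_DK | now apply gbase_zgen]. }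
  eapply hom_trans; [now apply rho_zgen|].
  apply ev_solve; [apply gen_loops | now apply zloop_is_loop, zimg_clear | now apply image_relation].
Qed.

(** Translates the relations, which are stated as products of loops, into words on which
    certificates can be evaluated. *)
Definition reads (x : nat -> R -> C) (a : R -> C) (w : list Z) : Prop :=
  is_loop a /\ hom DK a (ev x w).

Lemma reads_letter x a : loops x -> reads x (letter x a) [a].
Proof.
  intros Hx; split; [auto with loop|]; apply hom_sym, lhom_lone_r; auto with loop.
Qed.

Lemma reads_lmul x a b u v : loops x -> reads x a u -> reads x b v -> reads x (lmul a b) (u ++ v).
Proof.
  intros Hx [La Ha] [Lb Hb]; split; [auto with loop|].
  eapply hom_trans; [|apply hom_sym, ev_app, Hx]; auto with loop.
Qed.

Lemma reads_linv x a u : loops x -> reads x a u -> reads x (linv a) (winv u).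
Proof.
  intros Hx [La Ha]; split; [auto with loop|].
  eapply hom_trans; [apply hom_inv, Ha | now apply ev_winv].
Qed.

Lemma nc_reads rels x a w : reads x a w -> normal_closure rels a <-> normal_closure rels (ev x w).
Proof.
  intros [La Ha]; split; apply nc_hom; trivial; [now apply hom_sym|].
  now apply is_loop_hom with a.
Qed.

Definition monodromy_relators : list (list Z) :=
  map (fun i => braid_word i ++ winv [Z.of_nat i]) [1; 2; 3; 4; 5]%nat.

Definition local_relators : list (list Z) :=
  [[4; 3; 2] ++ winv [2; 4; 3];
   [3; 2; 4; 3; 4] ++ winv [4; 3; 2; 4; 3];
   [1] ++ winv ([4; 3] ++ winv [4]);
   [4] ++ winv [5]]%Z.

Theorem corollary4p8 (beta : C -> C) (x : nat -> R -> C)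
    (Hbeta : local_braid_monodromy beta) (Hx : standard_gbase x) :
  let x1 := x 1%nat in let x2 := x 2%nat in let x3 := x 3%nat in
  let x4 := x 4%nat in let x5 := x 5%nat in
  same_normal_closure
    (monodromy_relations beta x)
    [ ((x4 * x3 * x2)%L, (x2 * x4 * x3)%L);
      ((x3 * x2 * x4 * x3 * x4)%L, (x4 * x3 * x2 * x4 * x3)%L);
      (x1, (x4 * x3 * x4^-1)%L);
      (x4, x5) ].
Proof.
  intros x1 x2 x3 x4 x5.
  set (rels := [((x4 * x3 * x2)%L, _); _; _; _]).
  (* Evaluation of words asks for a loop at every index, while a g-base is constrained only at 1,
     ..., 5; elsewhere [gen] is a default value. *)
  set (y := fun i => if ((1 <=? i)%nat && (i <=? 5)%nat)%bool then x i else gen i).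
  assert (Hidx : forall i, ((1 <=? i)%nat && (i <=? 5)%nat)%bool = true -> idx i)
    by (intros i; unfold idx; rewrite Bool.andb_true_iff, !Nat.leb_le; trivial).
  assert (Hyx : forall i, idx i -> y i = x i).
  { intros i Hi; unfold y; destruct (_ && _)%bool eqn:E; trivial.
    apply Bool.andb_false_iff in E; rewrite !Nat.leb_nle in E; destruct Hi; lia. }
  assert (Hy : loops y).
  { intros i; unfold y; destruct (_ && _)%bool eqn:E; [|apply gen_loops].
    apply (gbase_loop x); auto. }
  assert (Hgy : forall i, hom DK (gen i) (y i)).
  { intros i; unfold y; destruct (_ && _)%bool eqn:E; [|apply lhom_refl, gen_loops].
    apply hom_sym, gbase_zgen; auto. }
  assert (Hbx : forall i, idx i -> reads y (fun t => beta (x i t)) (braid_word i)).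
  { intros i Hi; pose proof (braid_action beta x i Hbeta Hx Hi) as h; split.
    - apply is_loop_hom with (ev gen (braid_word i)); [apply is_loop_ev, gen_loops | now apply hom_sym].
    - eapply hom_trans; [exact h | apply ev_congr; trivial; apply gen_loops]. }
  (* For k from 1 to 5, [letter y k] computes to [x k], so this reads off every factor of the
     relations. *)
  assert (Hl : forall a, reads y (letter y a) [a]) by (intros; now apply reads_letter).
  pose proof (fun a b u v => reads_lmul y a b u v Hy) as Hm.
  pose proof (fun a u => reads_linv y a u Hy) as Hi.
  assert (HM : forall i, idx i -> reads y (lmul (fun t => beta (x i t)) (linv (x i)))
                 (braid_word i ++ winv [Z.of_nat i])).
  { intros i Hii; apply Hm; [now apply Hbx|]; apply Hi.
    rewrite <- Hyx by trivial; replace (y i) with (letter y (Z.of_nat i)); [apply Hl|].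
    destruct i; [destruct Hii; lia|]; simpl; now rewrite SuccNat2Pos.id_succ. }
  assert (R1 : reads y (lmul (x4 * x3 * x2)%L (linv (x2 * x4 * x3)%L)) (nth 0 local_relators [])).
  { apply Hm; [apply (Hm _ _ [4; 3]%Z [2]%Z); [apply (Hm _ _ [4]%Z [3]%Z)|]
              | apply Hi, (Hm _ _ [2; 4]%Z [3]%Z); [apply (Hm _ _ [2]%Z [4]%Z)|]];
      first [exact (Hl 2%Z) | exact (Hl 3%Z) | exact (Hl 4%Z)]. }
  assert (R2 : reads y (lmul (x3 * x2 * x4 * x3 * x4)%L (linv (x4 * x3 * x2 * x4 * x3)%L))
                 (nth 1 local_relators [])).
  { apply Hm; [|apply Hi].
    - apply (Hm _ _ [3; 2; 4; 3]%Z [4]%Z); [apply (Hm _ _ [3; 2; 4]%Z [3]%Z);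
        [apply (Hm _ _ [3; 2]%Z [4]%Z); [apply (Hm _ _ [3]%Z [2]%Z)|]|]|];
        first [exact (Hl 2%Z) | exact (Hl 3%Z) | exact (Hl 4%Z)].
    - apply (Hm _ _ [4; 3; 2; 4]%Z [3]%Z); [apply (Hm _ _ [4; 3; 2]%Z [4]%Z);
        [apply (Hm _ _ [4; 3]%Z [2]%Z); [apply (Hm _ _ [4]%Z [3]%Z)|]|]|];
        first [exact (Hl 2%Z) | exact (Hl 3%Z) | exact (Hl 4%Z)]. }
  assert (R3 : reads y (lmul x1 (linv (x4 * x3 * x4^-1)%L)) (nth 2 local_relators [])).
  { apply Hm; [exact (Hl 1%Z)|]; apply Hi, (Hm _ _ [4; 3]%Z [-4]%Z);
      [apply (Hm _ _ [4]%Z [3]%Z)|];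
      first [exact (Hl (-4)%Z) | exact (Hl 3%Z) | exact (Hl 4%Z)]. }
  assert (R4 : reads y (lmul x4 (linv x5)) (nth 3 local_relators [])).
  { apply Hm; [exact (Hl 4%Z) | apply Hi; exact (Hl 5%Z)]. }
  assert (NM : forall r, In r monodromy_relators ->
    normal_closure (monodromy_relations beta x) (ev y r)).
  { intros r Hr; apply in_map_iff in Hr; destruct Hr as (i & <- & Hin).
    assert (Hii : idx i) by (simpl in Hin; unfold idx; lia).
    apply (nc_reads _ _ _ _ (HM i Hii)).
    apply nc_rel; unfold monodromy_relations.
    now apply (in_map (fun j => ((fun t => beta (x j t)), x j))). }
  assert (NR : forall r, In r local_relators -> normal_closure rels (ev y r)).
  { intros r [<-|[<-|[<-|[<-|[]]]]];
      [apply (nc_reads _ _ _ _ R1) | apply (nc_reads _ _ _ _ R2)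
       | apply (nc_reads _ _ _ _ R3) | apply (nc_reads _ _ _ _ R4)];
      apply nc_rel; unfold rels; simpl; tauto. }
  intros a; split; apply nc_incl; clear a.
  - intros l r Hin; apply in_map_iff in Hin; destruct Hin as (i & [= <- <-] & Hin).
    assert (Hii : idx i) by (simpl in Hin; unfold idx; lia).
    apply (nc_reads _ _ _ _ (HM i Hii)).
    simpl in Hin; destruct Hin as [<-|[<-|[<-|[<-|[<-|[]]]]]].
    + apply (nc_consequence rels y local_relators [([], 2%nat, false)]); trivial.
    + apply (nc_consequence rels y local_relators [([], 0%nat, true)]); trivial.
    (* By (3) the image of x3 becomes x4 x3 x2 x4 x3 (x4 x3 x2 x4)^-1, by (2) this is x3 x2 x4 x3
       (x4 x3 x2)^-1, and by (1) it is x3. *)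
    + apply (nc_consequence rels y local_relators
        [([4; 3; 2]%Z, 2%nat, true); ([], 1%nat, false); ([3]%Z, 0%nat, false)]); trivial.
    + apply (nc_consequence rels y local_relators [([], 3%nat, false)]); trivial.
    (* By (4) and (3) the relator becomes x4^2 (x3 x2 x4 x3 x4) (x4^2 x4 x3 x2 x4 x3)^-1, which (2)
       makes trivial. *)
    + apply (nc_consequence rels y local_relators
        [([], 3%nat, false); ([4; 4; 3; 2]%Z, 2%nat, true);
         ([4; 4; 3; 2; 4; 3; 4; -3; -4]%Z, 2%nat, false);
         ([4; 4; 3; 2; 4; 3; 4; -3; -4; -2; -3; -4; -4]%Z, 3%nat, true);
         ([4; 4; 3; 2; 4; 3; 4; -3; -4; -2; -3; -4; -4; -4]%Z, 3%nat, true);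
         ([4; 4]%Z, 1%nat, true)]); trivial.
  - intros l r [[= <- <-]|[[= <- <-]|[[= <- <-]|[[= <- <-]|[]]]]].
    + apply (nc_reads _ _ _ _ R1).
      apply (nc_consequence _ y monodromy_relators [([], 1%nat, true)]); trivial.
    + apply (nc_reads _ _ _ _ R2).
      (* Exchanging x4 and x5 where needed and x4 x3 x4^-1 and x1, the word is turned into x4^-2 r
         x4^2, where r is the fifth monodromy relator. *)
      apply (nc_consequence _ y monodromy_relators
        [([3; 2; 4; 3; 4; -3; -4; -2; -3; -4; -4; -4]%Z, 3%nat, true);
         ([3; 2; 4; 3; 4; -3; -4; -2; -3; -4; -4]%Z, 3%nat, true);
         ([3; 2; 4; 3; 4; -3; -4]%Z, 0%nat, false); ([3; 2]%Z, 0%nat, true);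
         ([-4; -4]%Z, 3%nat, false); ([-4; -4]%Z, 4%nat, true)]); trivial.
    + apply (nc_reads _ _ _ _ R3).
      apply (nc_consequence _ y monodromy_relators [([], 0%nat, false)]); trivial.
    + apply (nc_reads _ _ _ _ R4).
      apply (nc_consequence _ y monodromy_relators [([], 3%nat, false)]); trivial.
Qed.
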